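(* Let $\Gamma$ be a countable group. If $\Gamma$ has the unique trace property then $\Gamma$ has no non-trivial amenable invariant random subgroups.
   Context: All groups are countable and discrete. $C^*_r(\Gamma)$ is the reduced $C^*$-algebra of $\Gamma$, i.e. the $C^*$-algebra generated by the operators $\lambda_\Gamma(\gamma)$, $\gamma\in\Gamma$, in $B(\ell^2(\Gamma))$, with $\lambda_\Gamma$ the left regular representation. $\Gamma$ has the unique trace property if there is a unique tracial state on $C^*_r(\Gamma)$. $\mathrm{Sub}_\Gamma\subseteq 2^\Gamma$ is the compact space of subgroups of $\Gamma$. An invariant random subgroup (IRS) of $\Gamma$ is a Borel probability measure $\theta$ on $\mathrm{Sub}_\Gamma$ invariant under conjugation by $\Gamma$. It is amenable if $\theta$-almost every subgroup is amenable. It is non-trivial if it is not the point mass at the trivial subgroup $\{e\}$. *)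

(* Defs.v *)
From HB Require Import structures.
From mathcomp Require Import all_boot all_order all_algebra complex.
From mathcomp Require Import all_classical all_reals all_analysis.
From mathcomp Require Import ring.

Set Implicit Arguments.
Unset Strict Implicit.
Unset Printing Implicit Defensive.

Import Order.TTheory GRing.Theory Num.Theory.
Import numFieldNormedType.Exports.

Local Open Scope classical_set_scope.
Local Open Scope ring_scope.


Section SquareSummable.
Variables (R : realType) (G : groupType).
Implicit Types (f : G -> R[i]^o) (z : R[i]).

Definition sqmod z : R := complex.Re z ^+ 2 + complex.Im z ^+ 2.

Lemma sqmod_ge0 z : 0 <= sqmod z.
Proof. by rewrite addr_ge0 ?sqr_ge0. Qed.

Definition square_summable : {pred G -> R[i]^o} :=
  fun f => (\esum_(g in [set: G]) (sqmod (f g))%:E < +oo)%E.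

Lemma sqmodZD z1 z2 z3 :
  sqmod (z1 * z2 + z3) <= (2 * sqmod z1) * sqmod z2 + 2 * sqmod z3.
Proof.
case: z1 z2 z3 => [a b] [c d] [e f]; rewrite /sqmod /=.
set u := a * c - b * d; set v := a * d + b * c.
have -> : 2 * (a ^+ 2 + b ^+ 2) * (c ^+ 2 + d ^+ 2) =
          2 * (u ^+ 2 + v ^+ 2) by rewrite /u /v; ring.
rewrite -subr_ge0.
have -> : 2 * (u ^+ 2 + v ^+ 2) + 2 * (e ^+ 2 + f ^+ 2) -
   ((u + e) ^+ 2 + (v + f) ^+ 2) = (u - e) ^+ 2 + (v - f) ^+ 2 by ring.
by rewrite addr_ge0 ?sqr_ge0.
Qed.

Lemma esum_scale_lty (k : R) (a : G -> R) : 0 <= k -> (forall g, 0 <= a g) ->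
  (\esum_(g in [set: G]) (a g)%:E < +oo)%E ->
  (\esum_(g in [set: G]) (k * a g)%:E < +oo)%E.
Proof.
move=> k0 a0 aoo.
apply: (@le_lt_trans _ _ (k%:E * \esum_(g in [set: G]) (a g)%:E)%E).
  apply: ge_ereal_sup => _ [F [finF _] <-].
  rewrite (eq_fsbigr (fun g => (k%:E * (a g)%:E)%E)); last first.
    by move=> g _; rewrite EFinM.
  rewrite -ge0_mule_fsumr; last by move=> g; rewrite lee_fin.
  apply: lee_wpmul2l; first by rewrite lee_fin.
  by apply: ereal_sup_ubound; exists F.
rewrite lte_mul_pinfty ?lee_fin//.
Qed.

Lemma square_summable_submod : submod_closed square_summable.
Proof.
split=> [|z f1 f2 sf1 sf2]; rewrite /square_summable unfold_in.
  by rewrite esum1// => g _; rewrite /sqmod /= expr0n addr0.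
pose b1 g : R := (2 * sqmod z) * sqmod (f1 g).
pose b2 g : R := 2 * sqmod (f2 g).
have b10 g : 0 <= b1 g by rewrite /b1 !mulr_ge0 ?sqmod_ge0.
have b20 g : 0 <= b2 g by rewrite /b2 !mulr_ge0 ?sqmod_ge0.
apply: (@le_lt_trans _ _ (\esum_(g in [set: G]) ((b1 g)%:E + (b2 g)%:E))%E).
  by apply: le_esum => g _; rewrite -EFinD lee_fin sqmodZD.
rewrite esumD => [|g _|g _]; rewrite ?lee_fin//.
by apply: lte_add_pinfty; apply: esum_scale_lty => // *;
  rewrite ?mulr_ge0 ?sqmod_ge0.
Qed.

HB.instance Definition _ := GRing.isSubmodClosed.Build R[i] (G -> R[i]^o)
  square_summable square_summable_submod.

Record ell2 : Type := Ell2 {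
  ell2_val :> G -> R[i]^o;
  ell2_summable : ell2_val \in square_summable }.

HB.instance Definition _ := [isSub for ell2_val].
HB.instance Definition _ := [Choice of ell2 by <:].
HB.instance Definition _ := [SubChoice_isSubLmodule of ell2 by <:].

End SquareSummable.

Section Operators.
Variables (R : realType) (G : groupType).
Local Notation H := (ell2 R G).
Implicit Types (x y : H) (S T : H -> H).

Definition ell2_norm x : R :=
  Num.sqrt (fine (\esum_(g in [set: G]) (sqmod (x g))%:E)%E).

(* Unordered sum of an absolutely summable family, as the sum of the positive
   parts minus the sum of the negative parts. *)
Definition real_sum (a : G -> R) : R :=
  fine (\esum_(g in [set: G]) (Num.max (a g) 0)%:E)%E -
  fine (\esum_(g in [set: G]) (Num.max (- a g) 0)%:E)%E.

Definition complex_sum (a : G -> R[i]) : R[i] :=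
  (real_sum (fun g => complex.Re (a g)) +i*
   real_sum (fun g => complex.Im (a g)))%C.

Definition inner x y : R[i] := complex_sum (fun g => x g * (y g)^*%C).

Definition bounded_operator T : Prop :=
  linear T /\ exists M : R, forall x, ell2_norm (T x) <= M * ell2_norm x.

(* The supremum is finite on bounded operators, the only ones it is used for. *)
Definition op_norm T : R :=
  sup [set ell2_norm (T x) | x in [set x | ell2_norm x <= 1]].

(* S is the adjoint T^* of T. *)
Definition is_adjoint T S : Prop := forall x y, inner (T x) y = inner x (S y).

Record cstar_subalgebra (A : set (H -> H)) : Prop := CstarSubalgebra {
  csub_bounded : forall T, A T -> bounded_operator T;
  csub_zero : A (fun=> 0);
  csub_linear : forall (a : R[i]) S T, A S -> A T -> A (fun x => a *: S x + T x);
  csub_comp : forall S T, A S -> A T -> A (S \o T);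
  csub_adjoint : forall T S, A T -> is_adjoint T S -> A S;
  csub_closed : forall T, bounded_operator T ->
    (forall e : R, 0 < e -> exists2 S, A S & op_norm (fun x => T x - S x) < e) ->
    A T }.

Lemma left_translate_summable (g : G) x :
  (fun h => x (g^-1 * h)%g) \in @square_summable R G.
Proof.
have := ell2_summable x; rewrite /square_summable !unfold_in.
rewrite (@reindex_esum R G G setT setT (fun h => (g^-1 * h)%g))//.
split=> [//| |h _]; first by move=> h k _ _ /mulgI.
by exists (g * h)%g => //=; rewrite mulKg.
Qed.

Definition left_regular (g : G) x : H := Ell2 (left_translate_summable g x).

Definition reduced_cstar : set (H -> H) :=
  \bigcap_(A in [set A | cstar_subalgebra A /\ forall g, A (left_regular g)]) A.

(* A tracial state on C*_r(G) is a functional t on reduced_cstar; its values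
   outside of reduced_cstar are irrelevant.  The order on R[i] is the one for
   which 0 <= z means that z is real and nonnegative. *)
Record tracial_state (t : (H -> H) -> R[i]) : Prop := TracialState {
  trst_linear : forall (a : R[i]) S T, reduced_cstar S -> reduced_cstar T ->
    t (fun x => a *: S x + T x) = a * t S + t T;
  trst_unit : t idfun = 1;
  trst_pos : forall T S, reduced_cstar T -> is_adjoint T S -> 0 <= t (S \o T);
  trst_trace : forall S T, reduced_cstar S -> reduced_cstar T ->
    t (S \o T) = t (T \o S) }.

End Operators.

Definition unique_trace_property (R : realType) (G : groupType) : Prop :=
  exists2 t : (ell2 R G -> ell2 R G) -> R[i], tracial_state t &
    forall t', tracial_state t' -> forall T, @reduced_cstar R G T -> t' T = t T.


Section Subgroups.
Variable G : groupType.

Record subgroup : Type := Subgroup {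
  sg_mem :> G -> bool;
  sg_closed : group_closed sg_mem }.

Lemma subgroup_eqP (H K : subgroup) :
  sg_mem H = sg_mem K -> H = K.
Proof.
case: H K => [A HA] [B HB] /= eAB; case: _ / eAB in HB *.
by congr Subgroup; exact: Prop_irrelevance.
Qed.

HB.instance Definition _ := gen_eqMixin subgroup.
HB.instance Definition _ := gen_choiceMixin subgroup.

Lemma trivial_subgroup_closed : group_closed (pred1 (1%g : G)).
Proof.
split=> [|x y]; first by rewrite inE.
by rewrite !inE => /eqP-> /eqP->; rewrite divg1.
Qed.

Definition trivial_subgroup : subgroup := Subgroup trivial_subgroup_closed.

HB.instance Definition _ := isPointed.Build subgroup trivial_subgroup.

Lemma conj_subgroup_closed (g : G) (H : subgroup) :
  group_closed [pred x : G | (x ^ g)%g \in sg_mem H].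
Proof.
have [H1 HB] := sg_closed H; split=> [|x y]; rewrite !inE ?conj1g//.
by move=> Hx Hy; rewrite conjMg conjVg HB.
Qed.

(* In MathComp x ^ g = g^-1 x g, so this is g H g^-1. *)
Definition conj_subgroup (g : G) (H : subgroup) : subgroup :=
  Subgroup (conj_subgroup_closed g H).

Record subgroup_elt (H : subgroup) : Type := SubgroupElt {
  sg_val :> G;
  sg_valP : sg_val \in sg_mem H }.

HB.instance Definition _ (H : subgroup) := [isSub for @sg_val H].
HB.instance Definition _ (H : subgroup) := [Choice of subgroup_elt H by <:].
HB.instance Definition _ (H : subgroup) :=
  SubChoice_isSubGroup.Build G (sg_mem H) (subgroup_elt H) (sg_closed H).

(* The topology that Sub_G inherits from 2^G, i.e. from the topology of
   pointwise convergence on functions from G to the discrete space bool. *)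
Definition subgroup_space : Type :=
  initial_topology (sg_mem : subgroup -> {ptws G -> bool}).

HB.instance Definition _ := Topological.on subgroup_space.
HB.instance Definition _ := Pointed.on subgroup_space.

Definition subgroup_borel : Type :=
  g_sigma_algebraType (@open subgroup_space).

End Subgroups.

(* K carries a left-invariant mean on bounded real functions; the values of m
   on unbounded functions are irrelevant. *)
Definition amenable (R : realType) (K : groupType) : Prop :=
  exists m : (K -> R) -> R,
    [/\ forall (a : R) (f1 f2 : K -> R),
          bounded_fun f1 -> bounded_fun f2 ->
          m (fun x => a * f1 x + f2 x) = a * m f1 + m f2,
        m (fun=> 1) = 1,
        forall f : K -> R, bounded_fun f -> (forall x, 0 <= f x) -> 0 <= m f &
        forall (g : K) (f : K -> R), bounded_fun f ->
          m (fun x => f (g * x)%g) = m f].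


Section InvariantRandomSubgroups.
Variables (R : realType) (G : groupType).
Implicit Type theta : probability (subgroup_borel G) R.

Definition invariant_random_subgroup theta : Prop :=
  forall (g : G) (A : set (subgroup_borel G)), measurable A ->
    theta (conj_subgroup g @^-1` A) = theta A.

Definition amenable_irs theta : Prop :=
  {ae theta, forall H : subgroup_borel G, amenable R (subgroup_elt H)}.

(* Measures are compared on measurable sets only: a MathComp-Analysis measure
   is a function on all subsets, unconstrained on the non-measurable ones. *)
Definition trivial_irs theta : Prop :=
  forall A : set (subgroup_borel G), measurable A ->
    theta A = \d_(trivial_subgroup G : subgroup_borel G) A.

End InvariantRandomSubgroups.

(* Main.v *)
Require Import Defs.
From HB Require Import structures.
From mathcomp Require Import all_boot all_order all_algebra complex.
From mathcomp Require Import all_classical all_reals all_analysis.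
From mathcomp Require Import ring lra.

(** For an invariant random subgroup [theta], the function
    [phi g = theta {S | g \in S}] is central, positive definite and satisfies
    [phi 1 = 1]. If a subgroup [S] is amenable, its indicator function extends
    to a state of C*_r(G): evaluate vector states at square roots of almost
    invariant probability measures on [S] (Reiter's condition). Integrating
    over [theta], an amenable [theta] makes [phi] extend to a tracial state of
    C*_r(G). The trivial subgroup gives the canonical trace in the same way,
    so a unique trace forces [phi g = 0] for all [g != 1], and by countability
    of [G] almost every subgroup is trivial. *)

Set Implicit Arguments.
Unset Strict Implicit.
Unset Printing Implicit Defensive.

Import Order.TTheory GRing.Theory Num.Theory.
Import numFieldNormedType.Exports.

Local Open Scope classical_set_scope.
Local Open Scope ring_scope.

(** * Sublinear functionals and the Hahn-Banach theorem *)

Section HahnBanach.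
Variables (R : realType) (V : lmodType R).
Implicit Types (p q f : V -> R) (F : set (V -> R)).

(** No state is chosen for each amenable subgroup, since integrating such a choice would require it
    to depend measurably on the subgroup. For one fixed finite combination [l] of group elements,
    continuity and positivity amount to inequalities between finite sums of indicators of [g \in S],
    and these can be integrated once the sets of subgroups containing a given [g] are measurable.
    Continuity is stated as a bound on the real part: such a bound is linear in [phi], hence
    survives integration, and multiplying [l] by scalars of modulus one recovers the imaginary part.
    The real inner product is then enough for the operator estimates.

    C*_r(G) is given as an intersection of algebras, which describes its elements only from outside.
    They are therefore shown to be norm limits of finite combinations, and traces are built as
    limits of values on combinations. Adjoints are a relation between maps, so linearity and
    boundedness of an adjoint are also derived by approximation. *)

Definition sublinear p : Prop :=
  (forall u v, p (u + v) <= p u + p v) /\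
  (forall (c : R) v, 0 < c -> p (c *: v) <= c * p v).

(** Serves three times: for lower bounds of chains, for translates in the Hahn-Banach argument, and
    for the separation in Reiter's condition. *)
Definition inf_family F (v : V) : R := inf [set f v | f in F].

Section InfFamily.
Variable F : set (V -> R).
Hypothesis F0 : F !=set0.
Hypothesis F_lb : forall v, exists b, forall f, F f -> b <= f v.

Lemma inf_family_le f v : F f -> inf_family F v <= f v.
Proof.
move=> Ff; apply: ge_inf; last by exists f.
by have [b bF] := F_lb v; exists b => _ [g Fg <-]; exact: bF.
Qed.

Lemma le_inf_family b v : (forall f, F f -> b <= f v) -> b <= inf_family F v.
Proof.
move=> bF; have [f Ff] := F0.
by apply: lb_le_inf => [|_ [g Fg <-]]; [exists (f v), f|exact: bF].
Qed.

(** The members of [F] need not be sublinear: it suffices that [F] is stable, up to domination,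
    under sums and dilations taken across different members. *)
Lemma inf_family_sublinear :
  (forall f g u v, F f -> F g -> exists2 h, F h & h (u + v) <= f u + g v) ->
  (forall f (c : R) v, F f -> 0 < c -> exists2 h, F h & h (c *: v) <= c * f v) ->
  sublinear (inf_family F).
Proof.
move=> FD FZ; split=> [u v|c v c0].
  rewrite -lerBlDr; apply: le_inf_family => f Ff.
  rewrite lerBlDr -lerBlDl; apply: le_inf_family => g Fg.
  rewrite lerBlDl; have [h Fh] := FD f g u v Ff Fg.
  exact/le_trans/inf_family_le.
rewrite -ler_pdivrMl//; apply: le_inf_family => f Ff.
rewrite ler_pdivrMl//; have [h Fh] := FZ f c v Ff c0.
exact/le_trans/inf_family_le.
Qed.

End InfFamily.

Lemma sublinear_ge p v : sublinear p -> - p (- v) <= p v.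
Proof.
move=> [pD _]; have := pD v (- v); have := pD 0 0; rewrite subrr addr0.
by lra.
Qed.

Lemma sublinear_scale p (t : R) v : sublinear p -> 0 <= t -> t * p v <= p (t *: v).
Proof.
move=> [pD pZ]; rewrite le_eqVlt => /predU1P[<-|t0].
  by rewrite scale0r mul0r; have := pD 0 0; rewrite addr0; lra.
rewrite -ler_pdivlMl//; apply: le_trans (pZ _ _ _); rewrite ?invr_gt0//.
by rewrite scalerA mulVf ?gt_eqF// scale1r.
Qed.

(* Translating a sublinear functional along [y] gives a smaller sublinear
   functional, so the minimal ones are additive. *)
Lemma hahn_banach q : sublinear q ->
  exists2 f, {morph f : u v / u + v} & forall v, f v <= q v.
Proof.
move=> ql; pose T := {p | sublinear p /\ forall v, p v <= q v}.
pose mk p P : T := exist _ p P.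
(* The order is reversed, so that a maximal element in Zorn's lemma is a pointwise minimal
   functional. *)
pose le (s t : T) := `[< forall v, sval t v <= sval s v >].
have [|||A totA|[p [pl pq]] pmin] := @Zorn T le.
- by move=> t; apply/asboolP.
- move=> r s t /asboolP rs /asboolP st; apply/asboolP => v.
  exact: le_trans (st v) (rs v).
- move=> [s Ps] [t Pt] /asboolP /= st /asboolP /= ts.
  by apply: eq_exist; apply/funext => v; apply/le_anti; rewrite ts st.
- have [->|/set0P[p0 Ap0]] := eqVneq A set0.
    by exists (mk q (conj ql (fun v => lexx _))) => s.
  pose F := [set sval s | s in A].
  have F0 : F !=set0 by exists (sval p0), p0.
  have F_lb v : exists b, forall f, F f -> b <= f v.
    (* Every member of the chain is below [q], whence [- q (- v) <= - p (- v) <= p v]. *)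
    exists (- q (- v)) => _ [[p [pl pq]] _ <-] /=.
    by rewrite (le_trans _ (sublinear_ge v pl))// lerN2.
  have Fsub : sublinear (inf_family F).
    apply: inf_family_sublinear => // [_ _ u v [s As <-] [t At <-]|_ c v [s As <-] c0].
      have [/asboolP st|/asboolP ts] := totA _ _ As At.
        exists (sval t); first by exists t.
        by rewrite (le_trans ((svalP t).1.1 u v))// lerD2r.
      exists (sval s); first by exists s.
      by rewrite (le_trans ((svalP s).1.1 u v))// lerD2l.
    by exists (sval s); [exists s|exact: (svalP s).1.2].
  have Fq v : inf_family F v <= q v.
    apply: le_trans ((svalP p0).2 v); apply: inf_family_le => //.
    by exists p0.
  exists (mk _ (conj Fsub Fq)) => s As; apply/asboolP => v /=.
  by apply: inf_family_le => //; exists s.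
exists p => // u y.
pose F := [set (fun v => p (v + t *: y) - t * p y) | t in [set t : R | 0 <= t]].
have F0 : F !=set0 by exists (fun v => p (v + 0 *: y) - 0 * p y), 0 => //=.
have F_lb v : exists b, forall f, F f -> b <= f v.
  exists (- p (- v)) => _ [t /= t0 <-].
  have := sublinear_scale y pl t0; have := pl.1 (v + t *: y) (- v).
  by rewrite addrAC subrr add0r; lra.
have Fsub : sublinear (inf_family F).
  apply: inf_family_sublinear => // [_ _ v w [s s0 <-] [t t0 <-]|_ c v [t t0 <-] c0].
    exists (fun v => p (v + (s + t) *: y) - (s + t) * p y).
      by exists (s + t) => //=; rewrite addr_ge0.
    by have := pl.1 (v + s *: y) (w + t *: y); rewrite addrACA -scalerDl; lra.
  exists (fun v => p (v + (c * t) *: y) - (c * t) * p y).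
    by exists (c * t) => //=; rewrite mulr_ge0// ltW.
  have := pl.2 c (v + t *: y) c0; rewrite scalerDr scalerA; lra.
have Fp v : inf_family F v <= p v.
  rewrite (_ : p v = p (v + 0 *: y) - 0 * p y); last first.
    by rewrite scale0r addr0 mul0r subr0.
  apply: (@inf_family_le F F_lb (fun w => p (w + 0 *: y) - 0 * p y)).
  by exists 0 => /=.
have Fq v : inf_family F v <= q v := le_trans (Fp v) (pq v).
have pF : inf_family F = p.
  have := pmin (mk _ (conj Fsub Fq)).
  by move=> /(_ (asboolT Fp)) /(congr1 sval).
apply/le_anti; rewrite pl.1/=.
(* By minimality the infimum over [t] is [p] itself; its member [t = 1] gives the converse of
   subadditivity. *)
have : inf_family F u <= p (u + 1 *: y) - 1 * p y.
  apply: (@inf_family_le F F_lb (fun w => p (w + 1 *: y) - 1 * p y)).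
  by exists 1 => /=.
by rewrite pF scale1r; lra.
Qed.

End HahnBanach.

(** * Sums of absolutely summable real families *)

Section RealSums.
Variables (R : realType) (T : choiceType).
Implicit Types (a b : T -> R).

Definition abs_summable a : Prop := (\esum_(x in [set: T]) `|a x|%:E < +oo)%E.

(** Same body as [real_sum], over any index type; on a group the two are convertible, which
    [Re_inner] exploits. *)
Definition rsum a : R :=
  fine (\esum_(x in [set: T]) (Num.max (a x) 0)%:E)%E -
  fine (\esum_(x in [set: T]) (Num.max (- a x) 0)%:E)%E.

Lemma abs_summable_le a b :
  (forall x, `|a x| <= b x) -> abs_summable b -> abs_summable a.
Proof.
move=> ab; apply: le_lt_trans; apply: le_esum => x _.
by rewrite lee_fin (le_trans (ab x))// ler_norm.
Qed.

Lemma abs_summable0 : abs_summable (fun=> 0).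
Proof. by rewrite /abs_summable esum1// => x _; rewrite normr0. Qed.

Lemma abs_summableD a b : abs_summable a -> abs_summable b ->
  abs_summable (fun x => a x + b x).
Proof.
move=> sa sb; apply: (@abs_summable_le _ (fun x => `|a x| + `|b x|)).
  by move=> x; exact: ler_normD.
rewrite /abs_summable (eq_esum (b := fun x => (`|a x|%:E + `|b x|%:E)%E)).
  by rewrite esumD// lte_add_pinfty.
by move=> x _; rewrite ger0_norm ?addr_ge0.
Qed.

(** Finite partial sums give [<=] for every positive factor; this bound for [k^-1] gives the
    converse. *)
Lemma esum_scale (k : R) a : 0 <= k -> (forall x, 0 <= a x) ->
  (\esum_(x in [set: T]) (k * a x)%:E = k%:E * \esum_(x in [set: T]) (a x)%:E)%E.
Proof.
rewrite le_eqVlt => /predU1P[<- _|].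
  by rewrite mul0e esum1// => x _; rewrite mul0r.
have le_scale (c : R) f : 0 < c -> (forall x, 0 <= f x) ->
    (\esum_(x in [set: T]) (c * f x)%:E <= c%:E * \esum_(x in [set: T]) (f x)%:E)%E.
  move=> c0 f0; apply: ge_ereal_sup => _ [F [finF _] <-].
  rewrite (eq_fsbigr (fun x => (c%:E * (f x)%:E)%E)) => [|x _]; last first.
    by rewrite EFinM.
  rewrite -ge0_mule_fsumr; last by move=> x; rewrite lee_fin.
  apply: lee_wpmul2l; first by rewrite lee_fin ltW.
  by apply: ereal_sup_ubound; exists F.
move=> k0 a0; apply/le_anti; rewrite le_scale//=.
rewrite muleC -lee_pdivlMr//.
rewrite [leLHS](eq_esum (b := fun x => (k^-1 * (k * a x))%:E)) => [|x _].
  rewrite muleC le_scale ?invr_gt0// => x.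
  by rewrite mulr_ge0// ltW.
by rewrite mulrA mulVf ?gt_eqF// mul1r.
Qed.

Lemma abs_summableZ (k : R) a : abs_summable a -> abs_summable (fun x => k * a x).
Proof.
move=> sa; rewrite /abs_summable.
rewrite (eq_esum (b := fun x => (`|k| * `|a x|)%:E)) => [|x _].
  by rewrite esum_scale// lte_mul_pinfty ?lee_fin.
by rewrite normrM.
Qed.

Lemma abs_summableN a : abs_summable a -> abs_summable (fun x => - a x).
Proof.
by move=> /(abs_summableZ (-1)); congr abs_summable; apply/funext => x; rewrite mulN1r.
Qed.

Lemma abs_summableB a b : abs_summable a -> abs_summable b ->
  abs_summable (fun x => a x - b x).
Proof. by move=> sa /abs_summableN; exact: abs_summableD. Qed.

Lemma abs_summable_abs a : abs_summable a -> abs_summable (fun x => `|a x|).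
Proof.
by apply: le_lt_trans; apply: le_esum => x _; rewrite lee_fin normr_id.
Qed.

Lemma eq_rsum a b : a =1 b -> rsum a = rsum b.
Proof. by move=> /funext->. Qed.

Lemma rsum_nneg a : (forall x, 0 <= a x) ->
  rsum a = fine (\esum_(x in [set: T]) (a x)%:E)%E.
Proof.
move=> a0; rewrite /rsum [X in _ - fine X]esum1 ?subr0 => [|x _].
  by congr fine; apply: eq_esum => x _; rewrite max_l.
by rewrite max_r// oppr_le0.
Qed.

Lemma esum_fin_num a : (forall x, 0 <= a x) -> abs_summable a ->
  (\esum_(x in [set: T]) (a x)%:E)%E \is a fin_num.
Proof.
move=> a0 sa; rewrite fin_numElt (lt_le_trans (ltNyr 0%R)) ?esum_ge0//=; last first.
  by move=> x _; rewrite lee_fin.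
apply: le_lt_trans sa; apply: le_esum => x _.
by rewrite lee_fin ler_norm.
Qed.

Lemma rsumE a : (forall x, 0 <= a x) -> abs_summable a ->
  (\esum_(x in [set: T]) (a x)%:E)%E = (rsum a)%:E.
Proof. by move=> a0 sa; rewrite rsum_nneg// fineK// esum_fin_num. Qed.

Lemma rsum_ge0 a : (forall x, 0 <= a x) -> 0 <= rsum a.
Proof. by move=> a0; rewrite rsum_nneg//; apply/fine_ge0/esum_ge0 => x _; rewrite lee_fin. Qed.

Lemma rsum_nnegD a b : (forall x, 0 <= a x) -> (forall x, 0 <= b x) ->
  abs_summable a -> abs_summable b -> rsum (fun x => a x + b x) = rsum a + rsum b.
Proof.
move=> a0 b0 sa sb; rewrite !rsum_nneg//; last by move=> x; rewrite addr_ge0.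
rewrite -fineD ?esum_fin_num// -esumD => [|x _|x _]; rewrite ?lee_fin//.
Qed.

Lemma abs_summable_pos a : abs_summable a ->
  abs_summable (fun x => Num.max (a x) 0).
Proof.
apply: le_lt_trans; apply: le_esum => x _; rewrite lee_fin.
by rewrite ger0_norm ?ge_max ?ler_norm ?normr_ge0// le_max lexx orbT.
Qed.

Lemma rsum_split a :
  rsum a = rsum (fun x => Num.max (a x) 0) - rsum (fun x => Num.max (- a x) 0).
Proof. by rewrite 2?[in RHS]rsum_nneg// => x; rewrite le_max lexx orbT. Qed.

(** Any decomposition into nonnegative summable parts computes the sum:
    [(a - b)^+ + b = (a - b)^- + a] holds pointwise, and both sides are sums of nonnegative
    functions. *)
Lemma rsum_nnegB a b : (forall x, 0 <= a x) -> (forall x, 0 <= b x) ->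
  abs_summable a -> abs_summable b -> rsum (fun x => a x - b x) = rsum a - rsum b.
Proof.
move=> a0 b0 sa sb; rewrite rsum_split; apply/eqP.
rewrite subr_eq addrAC eq_sym subr_eq addrC eq_sym [eqbRHS]addrC.
have max0 (c : R) : 0 <= Num.max c 0 by rewrite le_max lexx orbT.
have sab := abs_summable_pos (abs_summableB sa sb).
have sba : abs_summable (fun x => Num.max (- (a x - b x)) 0).
  exact/abs_summable_pos/abs_summableN/abs_summableB.
rewrite -!rsum_nnegD//; apply/eqP/eq_rsum => x.
by case: (leP (a x - b x) 0) => ?; case: (leP (- (a x - b x)) 0) => ?; lra.
Qed.

Lemma rsumD a b : abs_summable a -> abs_summable b ->
  rsum (fun x => a x + b x) = rsum a + rsum b.
Proof.
move=> sa sb.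
have max0 (c : R) : 0 <= Num.max c 0 by rewrite le_max lexx orbT.
rewrite [rsum a]rsum_split [rsum b]rsum_split.
have pa := abs_summable_pos sa; have pb := abs_summable_pos sb.
have na := abs_summable_pos (abs_summableN sa).
have nb := abs_summable_pos (abs_summableN sb).
rewrite addrACA -opprD -!rsum_nnegD// -rsum_nnegB//.
- apply: eq_rsum => x.
  by case: (leP (a x) 0) => ?; case: (leP (- a x) 0) => ?;
     case: (leP (b x) 0) => ?; case: (leP (- b x) 0) => ?; lra.
- by move=> x; rewrite addr_ge0.
- by move=> x; rewrite addr_ge0.
- exact: abs_summableD.
- exact: abs_summableD.
Qed.

Lemma rsumN a : rsum (fun x => - a x) = - rsum a.
Proof.
by rewrite /rsum opprB; congr (_ - fine (esum _ _)); apply/funext => x; rewrite opprK.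
Qed.

Lemma rsumB a b : abs_summable a -> abs_summable b ->
  rsum (fun x => a x - b x) = rsum a - rsum b.
Proof. by move=> sa sb; rewrite rsumD ?rsumN//; exact: abs_summableN. Qed.

Lemma rsumZ (k : R) a : abs_summable a -> rsum (fun x => k * a x) = k * rsum a.
Proof.
move=> sa; wlog k0 : k / 0 <= k => [wlogk|].
  have [/wlogk//|k0] := leP 0 k.
  rewrite -[RHS]opprK -mulNr -wlogk ?oppr_ge0 ?ltW// -rsumN.
  by apply: eq_rsum => x; rewrite mulNr opprK.
have max0 (c : R) : 0 <= Num.max c 0 by rewrite le_max lexx orbT.
have rsumZ0 f : (forall x, 0 <= f x) -> abs_summable f ->
    rsum (fun x => k * f x) = k * rsum f.
  move=> f0 sf; rewrite !rsum_nneg//; last by move=> x; rewrite mulr_ge0.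
  by rewrite esum_scale// fineM// esum_fin_num.
have pa := abs_summable_pos sa.
have na := abs_summable_pos (abs_summableN sa).
rewrite [rsum a]rsum_split mulrBr -!rsumZ0// -rsumB; [|exact: abs_summableZ..].
apply: eq_rsum => x; rewrite -mulrBr; congr (_ * _).
by case: (leP (a x) 0) => ?; case: (leP (- a x) 0) => ?; lra.
Qed.

Lemma ler_rsum a b : abs_summable a -> abs_summable b ->
  (forall x, a x <= b x) -> rsum a <= rsum b.
Proof.
move=> sa sb ab; rewrite -subr_ge0 -rsumB// rsum_ge0// => x.
by rewrite subr_ge0.
Qed.

Lemma rsum0 : rsum (fun=> 0) = 0.
Proof. by rewrite rsum_nneg// esum1. Qed.

Lemma rsum_eq0 a : (forall x, 0 <= a x) -> abs_summable a -> rsum a = 0 ->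
  forall x, a x = 0.
Proof.
move=> a0 sa a_eq0 x; apply/le_anti; rewrite a0 andbT -lee_fin -a_eq0 -rsumE//.
apply: (@esum_ge _ _ [set: T]); exists [set x]; first by split.
by rewrite fsbig_set1.
Qed.

Definition delta (t x : T) : R := (x == t)%:R.

Lemma abs_summable_delta t : abs_summable (delta t).
Proof.
rewrite /abs_summable (esumID [set t])// setTI esum_set1// setTI esum1 => [|x /= /eqP xt].
  by rewrite adde0 ltry.
by rewrite /delta (negbTE xt) normr0.
Qed.

Lemma rsum_delta t : rsum (delta t) = 1.
Proof.
rewrite rsum_nneg => [|x]; last by rewrite /delta.
rewrite (esumID [set t])/=; last by move=> x _; rewrite lee_fin.
rewrite setTI esum_set1 ?lee_fin// setTI esum1 => [|x /= /eqP xt].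
  by rewrite adde0 /delta eqxx.
by rewrite /delta (negbTE xt).
Qed.

Lemma abs_summable_reindex (e : T -> T) a : bijective e ->
  abs_summable a -> abs_summable (a \o e).
Proof.
rewrite -setTT_bijective => eb; rewrite /abs_summable.
by rewrite (reindex_esum _ _ _ _ eb).
Qed.

Lemma rsum_reindex (e : T -> T) a : bijective e -> rsum (a \o e) = rsum a.
Proof.
rewrite -setTT_bijective => eb; rewrite /rsum.
by rewrite [in RHS](reindex_esum _ _ _ _ eb) [X in _ = _ - fine X](reindex_esum _ _ _ _ eb).
Qed.

End RealSums.

(** * The real space l^1 *)

Section L1.
Variables (R : realType) (T : choiceType).

Definition in_l1 : {pred T -> R^o} := fun f => `[< abs_summable f >].

Lemma in_l1_submod : submod_closed in_l1.
Proof.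
split=> [|c f g /asboolP sf /asboolP sg]; apply/asboolP.
  exact: abs_summable0.
by apply: abs_summableD => //; exact: abs_summableZ.
Qed.

HB.instance Definition _ := GRing.isSubmodClosed.Build R (T -> R^o)
  in_l1 in_l1_submod.

Record l1 : Type := L1 { l1_val :> T -> R^o; l1_valP : l1_val \in in_l1 }.

HB.instance Definition _ := [isSub for l1_val].
HB.instance Definition _ := [Choice of l1 by <:].
HB.instance Definition _ := [SubChoice_isSubLmodule of l1 by <:].

Implicit Types x y : l1.

Lemma l1_summable x : abs_summable x.
Proof. by have /asboolP := l1_valP x. Qed.

Definition l1_norm x : R := rsum (fun t => `|x t|).

Lemma l1_summable_abs x : abs_summable (fun t => `|x t|).
Proof. exact/abs_summable_abs/l1_summable. Qed.

Lemma l1_norm_ge0 x : 0 <= l1_norm x.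
Proof. exact: rsum_ge0. Qed.

Lemma ler_l1_normD x y : l1_norm (x + y) <= l1_norm x + l1_norm y.
Proof.
rewrite -rsumD; [|exact: l1_summable_abs..].
apply: ler_rsum => [||t]; last exact: ler_normD.
  exact: l1_summable_abs.
by apply: abs_summableD; exact: l1_summable_abs.
Qed.

Lemma l1_normZ (c : R) x : l1_norm (c *: x) = `|c| * l1_norm x.
Proof.
rewrite -rsumZ; last exact: l1_summable_abs.
by apply: eq_rsum => t; rewrite -normrM.
Qed.

Definition l1_delta t : l1 := L1 (asboolT (abs_summable_delta R t)).

Lemma l1_norm_delta t : l1_norm (l1_delta t) = 1.
Proof.
by rewrite -[RHS](rsum_delta R t); apply: eq_rsum => u; rewrite ger0_norm.
Qed.

End L1.

(** * Reiter's condition for amenable groups *)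

Section Reiter.
Variables (R : realType) (K : groupType).

Lemma mulg_bijective (g : K) : bijective (fun h => (g * h)%g).
Proof. by exists (fun h => (g^-1 * h)%g) => h; rewrite ?mulKg ?mulVKg. Qed.

Lemma l1_translate_subproof (g : K) (x : l1 R K) :
  (fun h => x (g^-1 * h)%g) \in @in_l1 R K.
Proof.
by apply/asboolP; exact: abs_summable_reindex (mulg_bijective _) (l1_summable x).
Qed.

Definition l1_translate (g : K) (x : l1 R K) : l1 R K :=
  L1 (l1_translate_subproof g x).

Lemma l1_translate_delta (g h : K) :
  l1_translate g (l1_delta R h) = l1_delta R (g * h)%g.
Proof.
apply: val_inj; apply/funext => k /=.
by rewrite /delta (can2_eq (mulVKg _) (mulKg _)).
Qed.

Lemma le_bounded_fun (T : Type) (f : T -> R) (M : R) :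
  (forall x, `|f x| <= M) -> bounded_fun f.
Proof.
move=> fM; exists M; split => [|c Mc x _]; first exact: num_real.
exact: le_trans (fM x) (ltW Mc).
Qed.

(** An invariant mean kills each difference [f i (s i * h) - f i h], hence their sum, but is at
    least [e] on a bounded function that is everywhere at least [e]. *)
Lemma invariant_mean_not_coboundary n (s : 'I_n -> K) (f : 'I_n -> K -> R) (e : R) :
  amenable R K -> 0 < e -> (forall i h, `|f i h| <= 1) ->
  ~ (forall h, e <= \sum_i (f i (s i * h)%g - f i h)).
Proof.
move=> [m [mlin m1 mpos minv]] e0 f1.
pose F (r : seq 'I_n) h := \sum_(i <- r) (f i (s i * h)%g - f i h).
have bdelta i : bounded_fun (fun h => f i (s i * h)%g - f i h).
  apply: (@le_bounded_fun _ _ 2) => h.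
  by rewrite (le_trans (ler_normB _ _))// (_ : 2 = 1 + 1)// lerD.
have mdelta i : m (fun h => f i (s i * h)%g - f i h) = 0.
  have bf : bounded_fun (f i) by exact: le_bounded_fun (f1 i).
  have bsf : bounded_fun (fun h => f i (s i * h)%g) by exact: le_bounded_fun.
  rewrite (_ : (fun h => _) = (fun h => (-1) * f i h + f i (s i * h)%g)).
    by rewrite mlin// minv// mulN1r addNr.
  by apply/funext => h; rewrite mulN1r addrC.
have b0 : bounded_fun (fun _ : K => 0 : R).
  by apply: (@le_bounded_fun _ _ 0) => h; rewrite normr0.
have m0 : m (fun=> 0) = 0.
  have := mlin 1 _ _ b0 b0.
  rewrite (_ : (fun _ => _) = (fun=> 0)); last first.
    by apply/funext => h; rewrite mulr0 addr0.
  by rewrite mul1r => /eqP; rewrite addrC -subr_eq subrr eq_sym => /eqP.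
(* The mean is linear on bounded functions only, so boundedness of the partial sums is carried
   through the induction. *)
have [bF mF] : bounded_fun (F (index_enum 'I_n)) /\ m (F (index_enum 'I_n)) = 0.
  elim: (index_enum _) => [|i r [bF mF]].
    by rewrite (_ : F [::] = fun=> 0)//; apply/funext => h; rewrite /F big_nil.
  have FE : F (i :: r) = fun h => 1 * (f i (s i * h)%g - f i h) + F r h.
    by apply/funext => h; rewrite /F big_cons mul1r.
  split; last by rewrite FE mlin// mdelta mF mulr0 addr0.
  rewrite FE; have [M [_ FM]] := bF.
  apply: (@le_bounded_fun _ _ (2 + (M + 1))) => h; rewrite mul1r.
  rewrite (le_trans (ler_normD _ _))// lerD//; last by apply: FM => //; rewrite ltrDl.
  by rewrite (le_trans (ler_normB _ _))// (_ : 2 = 1 + 1)// lerD.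
move=> Fe; have b1 : bounded_fun (fun _ : K => 1 : R).
  by apply: (@le_bounded_fun _ _ 1) => h; rewrite normr1.
have me : m (fun x => - e * 1 + F (index_enum 'I_n) x) = - e.
  by rewrite mlin// m1 mF addr0 mulr1.
have : 0 <= m (fun x => - e * 1 + F (index_enum 'I_n) x).
  apply: mpos => [|h]; last by rewrite mulr1 addrC subr_ge0 Fe.
  have [M [_ FM]] := bF.
  apply: (@le_bounded_fun _ _ (e + (M + 1))) => h; rewrite mulr1.
  rewrite (le_trans (ler_normD _ _))// lerD ?normrN ?(gtr0_norm e0)//.
  by apply: FM => //; rewrite ltrDl.
by rewrite me oppr_ge0 leNgt e0.
Qed.

(* If there were no almost invariant probability measures, Hahn-Banach
   separation in l^1 would give bounded functions [f i] for which
   [\sum_i (f i (s i * h) - f i h)] is bounded below by [e]. *)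
Lemma reiter n (s : 'I_n -> K) (e : R) : amenable R K -> 0 < e ->
  exists mu : l1 R K, [/\ forall h, 0 <= mu h, 0 < l1_norm mu &
    forall i, l1_norm (l1_translate (s i) mu - mu) <= e * l1_norm mu].
Proof.
move=> amK e0; apply: contrapT => noreiter.
pose V := {ffun 'I_n -> l1 R K}.
pose nrm (v : V) := \sum_i l1_norm (v i).
have nrmD (u v : V) : nrm (u + v) <= nrm u + nrm v.
  by rewrite -big_split ler_sum// => i _; rewrite ffunE ler_l1_normD.
have nrmZ (c : R) (v : V) : nrm (c *: v) = `|c| * nrm v.
  by rewrite mulr_sumr; apply: eq_bigr => i _; rewrite ffunE l1_normZ.
pose D (mu : l1 R K) : V := [ffun i => l1_translate (s i) mu - mu].
have DD (mu nu : l1 R K) : D (mu + nu) = D mu + D nu.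
  apply/ffunP => i; rewrite !ffunE.
  by rewrite addrACA -opprD; congr (_ - _); apply: val_inj.
have DZ (c : R) (mu : l1 R K) : D (c *: mu) = c *: D mu.
  apply/ffunP => i; rewrite !ffunE scalerBr; congr (_ - _).
  by apply: val_inj.
(* Additivity of the norm on the positive cone makes the term [- e * l1_norm mu] of [q] below
   compatible with sums. *)
have l1_norm_nnegD (mu nu : l1 R K) : (forall h, 0 <= mu h) ->
    (forall h, 0 <= nu h) -> l1_norm (mu + nu) = l1_norm mu + l1_norm nu.
  move=> mu0 nu0; rewrite -rsumD; [|exact: l1_summable_abs..].
  apply: eq_rsum => h; rewrite (_ : (mu + nu) h = mu h + nu h)//.
  by rewrite !ger0_norm ?addr_ge0.
have nD (mu : l1 R K) : (forall h, 0 <= mu h) -> e * l1_norm mu <= nrm (D mu).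
  move=> mu0; rewrite leNgt; apply/negP => Dmu; apply: noreiter.
  exists mu; split => // [|i].
    rewrite lt_def l1_norm_ge0 andbT; apply/eqP => n0.
    by move: Dmu; rewrite n0 mulr0 ltNge sumr_ge0// => i _; exact: l1_norm_ge0.
  apply: le_trans (ltW Dmu); rewrite /nrm (bigD1 i)//= !ffunE lerDl.
  by rewrite sumr_ge0// => j _; exact: l1_norm_ge0.
(* An additive [f] below all [q mu] satisfies [f <= nrm] (take [mu = 0]) and
   [f (D mu) >= e * l1_norm mu] (evaluate at [- D mu]). The failure of Reiter's condition, in the
   form [nD], is what bounds the family from below. *)
pose q (mu : l1 R K) (v : V) := nrm (v + D mu) - e * l1_norm mu.
pose F := [set q mu | mu in [set mu : l1 R K | forall h, 0 <= mu h]].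
have F0 : F !=set0 by exists (q 0), 0.
have F_lb v : exists b, forall f, F f -> b <= f v.
  exists (- nrm v) => _ [mu mu0 <-]; rewrite /q.
  have := nrmD (v + D mu) (- v); rewrite addrAC subrr add0r.
  have := nrmZ (-1) v; rewrite scaleN1r normrN1 mul1r => ->.
  by have := nD _ mu0; lra.
have Fsub : sublinear (inf_family F).
  apply: inf_family_sublinear => // [_ _ v w [s1 s0 <-] [t t0 <-]|_ c v [t t0 <-] c0].
    exists (q (s1 + t)); first by exists (s1 + t) => //= h; rewrite addr_ge0.
    rewrite /q.
    have := nrmD (v + D s1) (w + D t).
    by rewrite addrACA -DD l1_norm_nnegD//; lra.
  exists (q (c *: t)).
    by exists (c *: t) => //= h; rewrite mulr_ge0// ltW.
  by rewrite /q DZ -scalerDr nrmZ l1_normZ (gtr0_norm c0); lra.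
have [f fD fq] := hahn_banach Fsub.
have f0 : f 0 = 0 by apply: (addrI (f 0)); rewrite -fD !addr0.
have fN v : f (- v) = - f v by apply: (addrI (f v)); rewrite -fD !subrr.
have f_le v (mu : l1 R K) : (forall h, 0 <= mu h) -> f v <= nrm (v + D mu) - e * l1_norm mu.
  move=> mu0; rewrite (le_trans (fq v))//.
  by apply: (@inf_family_le _ _ F F_lb (q mu)); exists mu.
have D0 : D 0 = 0 by rewrite -(scale0r 0) DZ scale0r.
have l10 : l1_norm (0 : l1 R K) = 0 by rewrite -(scale0r 0) l1_normZ normr0 mul0r.
have f_nrm v : f v <= nrm v.
  by have := @f_le v 0 (fun=> lexx _); rewrite D0 addr0 l10 mulr0 subr0.
(* The bounded functions are the values of [f] on point masses in each coordinate. As [D] of the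
   point mass at [h] is the sum of the [E i (s i * h) - E i h], the lower bound on [f] becomes the
   one an invariant mean forbids. *)
pose E i h : V := [ffun j => if j == i then l1_delta R h else 0].
have nrmE i h : nrm (E i h) = 1.
  rewrite /nrm (bigD1 i)//= ffunE eqxx l1_norm_delta big1 ?addr0// => j ji.
  by rewrite ffunE (negbTE ji).
apply: (@invariant_mean_not_coboundary n s (fun i h => f (E i h)) e) => // [i h|h].
  rewrite ler_norml; apply/andP; split; last by rewrite -(nrmE i h).
  rewrite lerNl -fN (le_trans (f_nrm _))//.
  by rewrite -scaleN1r nrmZ normrN1 mul1r nrmE.
have fsum (r : seq 'I_n) (u : 'I_n -> V) : f (\sum_(i <- r) u i) = \sum_(i <- r) f (u i).
  by elim/big_rec2: _ => // i a b _ <-.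
rewrite (eq_bigr (fun i => f (E i (s i * h)%g - E i h))); last first.
  by move=> i _; rewrite fD fN.
rewrite -fsum (_ : \sum_i _ = D (l1_delta R h)).
  have := @f_le (- D (l1_delta R h)) (l1_delta R h) (fun=> ler0n _ _).
  rewrite addNr fN l1_norm_delta mulr1 /nrm big1; first by lra.
  by move=> i _; rewrite ffunE l10.
apply/ffunP => i; rewrite sum_ffunE (bigD1 i)//= !ffunE eqxx l1_translate_delta.
rewrite big1 ?addr0// => j ji; rewrite !ffunE eq_sym (negbTE ji) subr0//.
Qed.

End Reiter.

(** * Real Hilbert space structure of l^2(G) and left translations *)

Section Ell2.
Variables (R : realType) (G : groupType).
Local Notation H := (ell2 R G).
Local Notation normc := ComplexField.Normc.normc.
Implicit Types (x y z : H) (c : R[i]).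

(** The real part of [inner]. It determines the norm and suffices to exploit the adjoint
    relation. *)
Definition rinner x y : R := rsum (fun g =>
  complex.Re (x g) * complex.Re (y g) + complex.Im (x g) * complex.Im (y g)).

Lemma Re_inner x y : complex.Re (inner x y) = rinner x y.
Proof.
rewrite /rinner [LHS]/(rsum _); apply: eq_rsum => g.
by case: (x g) (y g) => [a b] [c d] /=; rewrite mulrN opprK.
Qed.

Lemma sqmod_summable x : abs_summable (fun g => sqmod (x g)).
Proof.
apply: le_lt_trans (ell2_summable x); apply: le_esum => g _.
by rewrite lee_fin ger0_norm ?sqmod_ge0.
Qed.

Lemma rinner_summable x y : abs_summable (fun g =>
  complex.Re (x g) * complex.Re (y g) + complex.Im (x g) * complex.Im (y g)).
Proof.
apply: abs_summable_le (abs_summableD (sqmod_summable x) (sqmod_summable y)) => g.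
rewrite /sqmod; move: (complex.Re (x g)) (complex.Im (x g)) => a b.
move: (complex.Re (y g)) (complex.Im (y g)) => c d.
rewrite ler_norml; apply/andP; split.
  by have := sqr_ge0 (a + c); have := sqr_ge0 (b + d); have := sqr_ge0 a;
     have := sqr_ge0 b; have := sqr_ge0 c; have := sqr_ge0 d; rewrite !sqrrD; lra.
by have := sqr_ge0 (a - c); have := sqr_ge0 (b - d); have := sqr_ge0 a;
   have := sqr_ge0 b; have := sqr_ge0 c; have := sqr_ge0 d; rewrite !sqrrB; lra.
Qed.

Lemma rinnerC x y : rinner x y = rinner y x.
Proof. by apply: eq_rsum => g; rewrite mulrC [X in _ + X]mulrC. Qed.

Lemma rinnerDl x y z : rinner (x + y) z = rinner x z + rinner y z.
Proof.
rewrite -rsumD; [|exact: rinner_summable..]; apply: eq_rsum => g.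
rewrite (_ : (x + y) g = x g + y g)// !raddfD/=.
by case: (x g) (y g) (z g) => [? ?] [? ?] [? ?] /=; ring.
Qed.

Lemma rinnerZl (t : R) x y : rinner (t%:C%C *: x) y = t * rinner x y.
Proof.
rewrite -rsumZ; last exact: rinner_summable; apply: eq_rsum => g.
rewrite (_ : (t%:C%C *: x) g = t%:C%C * x g)//.
by case: (x g) (y g) => [? ?] [? ?] /=; ring.
Qed.

Lemma rinnerNl x y : rinner (- x) y = - rinner x y.
Proof.
rewrite -rsumN; apply: eq_rsum => g.
rewrite (_ : (- x) g = - x g)//.
by case: (x g) (y g) => [? ?] [? ?] /=; ring.
Qed.

Lemma rinnerBl x y z : rinner (x - y) z = rinner x z - rinner y z.
Proof. by rewrite rinnerDl rinnerNl. Qed.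

Lemma rinnerDr x y z : rinner x (y + z) = rinner x y + rinner x z.
Proof. by rewrite ![rinner x _]rinnerC rinnerDl. Qed.

Lemma rinnerBr x y z : rinner x (y - z) = rinner x y - rinner x z.
Proof. by rewrite ![rinner x _]rinnerC rinnerBl. Qed.

Lemma rinner_ge0 x : 0 <= rinner x x.
Proof. by apply: rsum_ge0 => g; rewrite -!expr2 addr_ge0 ?sqr_ge0. Qed.

Lemma ell2_normE x : ell2_norm x = Num.sqrt (rinner x x).
Proof.
rewrite /ell2_norm /rinner rsum_nneg => [|g]; last first.
  by rewrite -!expr2 addr_ge0 ?sqr_ge0.
by congr (Num.sqrt (fine _)); apply: eq_esum => g _; rewrite -!expr2.
Qed.

Lemma ell2_norm_ge0 x : 0 <= ell2_norm x.
Proof. exact: sqrtr_ge0. Qed.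

Lemma sqr_ell2_norm x : ell2_norm x ^+ 2 = rinner x x.
Proof. by rewrite ell2_normE sqr_sqrtr// rinner_ge0. Qed.

Lemma ell2_norm_eq0 x : ell2_norm x = 0 -> x = 0.
Proof.
move=> x0; apply: val_inj; apply/funext => g /=.
have : rsum (fun g => sqmod (x g)) = 0.
  transitivity (rinner x x); last by rewrite -sqr_ell2_norm x0 expr0n.
  apply: eq_rsum => h.
  by rewrite -!expr2.
move=> sq0; have := rsum_eq0 (fun h => sqmod_ge0 (x h)) (sqmod_summable x) sq0 g.
rewrite /sqmod; case: (x g) => a b /= /eqP.
by rewrite paddr_eq0 ?sqr_ge0// !sqrf_eq0 => /andP[/eqP-> /eqP->].
Qed.

Lemma ler_rinner x y : rinner x y <= ell2_norm x * ell2_norm y.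
Proof.
set a := rinner x x; set b := rinner x y; set c := rinner y y.
have a0 : 0 <= a := rinner_ge0 _; have c0 : 0 <= c := rinner_ge0 _.
suff b2 : b ^+ 2 <= a * c.
  rewrite (le_trans (ler_norm _))// -sqrtr_sqr !ell2_normE -sqrtrM//.
  exact: ler_wsqrtr.
(* The pairs [(- b, a)] and [(c, - b)] turn this into [a * (a * c - b ^+ 2) >= 0] and
   [c * (a * c - b ^+ 2) >= 0]; when [a = c = 0], the pairs [(1, 1)] and [(1, -1)] force [b = 0]. *)
have polar (s t : R) : 0 <= s ^+ 2 * a + 2 * (s * t * b) + t ^+ 2 * c.
  have := rinner_ge0 (s%:C%C *: x + t%:C%C *: y).
  rewrite rinnerDl !rinnerDr !rinnerZl ![rinner _ (_ *: _)]rinnerC !rinnerZl.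
  by rewrite (rinnerC y x) -/a -/b -/c; lra.
have [a_eq0|a_neq0] := eqVneq a 0; last first.
  have {a_neq0} a_gt0 : 0 < a by rewrite lt_def a_neq0.
  by rewrite -(ler_pM2l a_gt0); have := polar (- b) a; lra.
have [c_eq0|c_neq0] := eqVneq c 0; last first.
  have {c_neq0} c_gt0 : 0 < c by rewrite lt_def c_neq0.
  by rewrite -(ler_pM2l c_gt0); have := polar c (- b); lra.
have := polar 1 1; have := polar 1 (-1); rewrite a_eq0 c_eq0 => ? ?.
by rewrite (_ : b = 0) ?expr0n ?mulr0//; lra.
Qed.

Lemma ler_ell2_normD x y : ell2_norm (x + y) <= ell2_norm x + ell2_norm y.
Proof.
rewrite -ler_sqr ?nnegrE ?addr_ge0 ?ell2_norm_ge0//.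
rewrite sqr_ell2_norm rinnerDl !rinnerDr sqrrD !sqr_ell2_norm (rinnerC y x).
by have := ler_rinner x y; lra.
Qed.

Lemma ell2_normZ c x : ell2_norm (c *: x) = normc c * ell2_norm x.
Proof.
rewrite !ell2_normE (_ : rinner _ _ = sqmod c * rinner x x); last first.
  rewrite -rsumZ; last exact: rinner_summable; apply: eq_rsum => g.
  rewrite (_ : (c *: x) g = c * x g)// /sqmod.
  by case: c (x g) => [? ?] [? ?] /=; ring.
by rewrite sqrtrM ?sqmod_ge0//; case: c.
Qed.

Lemma normc_real (t : R) : normc t%:C%C = `|t|.
Proof. by rewrite /= expr0n addr0 sqrtr_sqr. Qed.

Lemma ell2_normN x : ell2_norm (- x) = ell2_norm x.
Proof. by rewrite -scaleN1r ell2_normZ /= oppr0 expr0n/= addr0 sqrrN expr1n sqrtr1 mul1r. Qed.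

Lemma ell2_distC x y : ell2_norm (x - y) = ell2_norm (y - x).
Proof. by rewrite -ell2_normN opprB. Qed.

Lemma ell2_norm0 : ell2_norm (0 : H) = 0.
Proof. by rewrite -(scale0r 0) ell2_normZ /= !expr0n/= addr0 sqrtr0 mul0r. Qed.

Lemma left_regular1 x : left_regular 1%g x = x.
Proof. by apply: val_inj; apply/funext => g /=; rewrite invg1 mul1g. Qed.

Lemma left_regularM g h x : left_regular (g * h)%g x = left_regular g (left_regular h x).
Proof. by apply: val_inj; apply/funext => k /=; rewrite invgM mulgA. Qed.

Lemma left_regular_linear g : linear (@left_regular R G g).
Proof. by move=> c x y; apply: val_inj. Qed.

HB.instance Definition _ g :=
  GRing.isLinear.Build R[i] H H *:%R (left_regular g) (left_regular_linear g).

Lemma rinner_left_regular g x y : rinner (left_regular g x) (left_regular g y) = rinner x y.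
Proof. exact: rsum_reindex (mulg_bijective g^-1%g). Qed.

Lemma rinner_left_regularV g x y :
  rinner (left_regular g x) y = rinner x (left_regular g^-1%g y).
Proof. by rewrite -[RHS](rinner_left_regular g) -left_regularM mulgV left_regular1. Qed.

Lemma ell2_norm_left_regular g x : ell2_norm (left_regular g x) = ell2_norm x.
Proof. by rewrite !ell2_normE rinner_left_regular. Qed.

End Ell2.

(** * The group algebra acting on l^2(G) *)

Section GroupAlgebra.
Variables (R : realType) (G : groupType).
Local Notation H := (ell2 R G).
Implicit Types (l : seq (R[i] * G)) (phi : G -> R) (x y : H).

(** A list of weighted group elements stands for an element of the group algebra. Repetitions are
    allowed, so addition is concatenation and no normal form is maintained. *)
Definition lincomb l x : H := \sum_(p <- l) p.1 *: left_regular p.2 x.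

Definition linear_ext phi l : R[i] := \sum_(p <- l) p.1 * (phi p.2)%:C%C.

Lemma lincomb_linear l : linear (lincomb l).
Proof.
move=> c x y; rewrite /lincomb scaler_sumr -big_split/=; apply: eq_bigr => p _.
by rewrite linearP scalerDr !scalerA mulrC.
Qed.

HB.instance Definition _ l :=
  GRing.isLinear.Build R[i] H H *:%R (lincomb l) (lincomb_linear l).

Lemma Re_linear_ext phi l :
  complex.Re (linear_ext phi l) = \sum_(p <- l) complex.Re p.1 * phi p.2.
Proof.
rewrite /linear_ext raddf_sum; apply: eq_bigr => -[[a b] g] _ /=.
by rewrite mulr0 subr0.
Qed.

Lemma Im_linear_ext phi l :
  complex.Im (linear_ext phi l) = \sum_(p <- l) complex.Im p.1 * phi p.2.
Proof.
rewrite /linear_ext raddf_sum; apply: eq_bigr => -[[a b] g] _ /=.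
by rewrite mulr0 add0r.
Qed.

End GroupAlgebra.

(** * Norm bound for the indicator of an amenable subgroup *)

Section AmenableSubgroup.
Variables (R : realType) (G : groupType) (S : subgroup G).
Local Notation H := (ell2 R G).
Local Notation K := (subgroup_elt S).

Definition extend0 (a : K -> R) (g : G) : R :=
  if insub g is Some h then a h else 0.

Lemma extend0_val a (h : K) : extend0 a (val h) = a h.
Proof. by rewrite /extend0 valK. Qed.

Lemma extend0_out a g : g \notin sg_mem S -> extend0 a g = 0.
Proof. by move=> gS; rewrite /extend0 insubN. Qed.

Lemma extend0_comp (f : R -> R) a g : f 0 = 0 ->
  f (extend0 a g) = extend0 (f \o a) g.
Proof. by move=> f0; rewrite /extend0; case: insub. Qed.

Lemma esum_extend0 a :
  (\esum_(g in [set: G]) (extend0 a g)%:E = \esum_(h in [set: K]) (a h)%:E)%E.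
Proof.
rewrite (eq_esum (b := fun h => (extend0 a (val h))%:E)) => [|h _]; last first.
  by rewrite extend0_val.
rewrite -(esum_image [set: K] val (fun g => (extend0 a g)%:E)); last by move=> h k _ _ /val_inj.
rewrite [RHS]esum_mkcond; apply: eq_esum => g _; case: ifPn => // gS.
rewrite extend0_out//; apply: contra gS => gS.
by apply/mem_set; exists (SubgroupElt gS).
Qed.

Lemma abs_summable_extend0 a : abs_summable a -> abs_summable (extend0 a).
Proof.
rewrite /abs_summable -esum_extend0; congr (_ < _)%E; apply: eq_esum => g _.
by rewrite (extend0_comp (f := Num.norm)) ?normr0.
Qed.

Lemma rsum_extend0 a : (forall h, 0 <= a h) -> rsum (extend0 a) = rsum a.
Proof.
move=> a0; rewrite !rsum_nneg ?esum_extend0// => g.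
by rewrite /extend0; case: insub.
Qed.

Lemma extend0_translate a (k : K) (g : G) :
  extend0 a ((val k)^-1 * g)%g = extend0 (fun h => a (k^-1 * h)%g) g.
Proof.
have SM := group_closedM (sg_closed S).
rewrite {2}/extend0; case: insubP => [h _ <-|gS].
  by rewrite -extend0_val.
rewrite extend0_out//; apply: contra gS => kgS.
by rewrite -(mulVKg (val k) g) SM//; exact: sg_valP.
Qed.

Section SquareRoot.
Variables (mu : l1 R K).
Hypothesis mu_ge0 : forall h, 0 <= mu h.

Lemma sqrt_summable_subproof :
  (fun g => (extend0 (fun h => Num.sqrt (mu h)) g)%:C%C) \in @square_summable R G.
Proof.
rewrite /square_summable unfold_in.
rewrite (eq_esum (b := fun g => (extend0 mu g)%:E)) => [|g _].
  rewrite esum_extend0; apply: le_lt_trans (l1_summable mu); apply: le_esum => h _.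
  by rewrite lee_fin ler_norm.
congr EFin; rewrite /sqmod /= expr0n addr0 (extend0_comp (f := fun t => t ^+ 2)) ?expr0n//.
by rewrite /extend0; case: insub => //= h; rewrite sqr_sqrtr.
Qed.

Definition sqrt_l1 : H := Ell2 sqrt_summable_subproof.

Lemma rinner_sqrt_l1 : rinner sqrt_l1 sqrt_l1 = l1_norm mu.
Proof.
rewrite /l1_norm -rsum_extend0//; apply: eq_rsum => g /=.
rewrite mulr0 addr0 /extend0; case: insub => [h|]; last by rewrite mulr0.
by rewrite -expr2 sqr_sqrtr// ger0_norm.
Qed.

Lemma sqr_sqrtB (a b : R) : 0 <= a -> 0 <= b ->
  (Num.sqrt a - Num.sqrt b) ^+ 2 <= `|a - b|.
Proof.
move=> a0 b0; rewrite -{2}(sqr_sqrtr a0) -{2}(sqr_sqrtr b0) subr_sqr normrM.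
rewrite -real_normK ?num_real// expr2 ler_wpM2l//.
rewrite (le_trans (ler_normB _ _))// !ger0_norm ?sqrtr_ge0// ?addr_ge0 ?sqrtr_ge0//.
Qed.

(** The squared distance between [xi] and its translate is at most the l^1 distance between [mu] and
    its translate, by [sqr_sqrtB]. Since translation is isometric, it also equals twice the defect
    [l1_norm mu - rinner eta xi]. *)
Lemma rinner_sqrt_translate (k : K) :
  `|rinner (left_regular (val k) sqrt_l1) sqrt_l1 - l1_norm mu| <=
  l1_norm (l1_translate k mu - mu).
Proof.
set xi := sqrt_l1; set eta := left_regular (val k) xi.
have eta_xi : rinner (eta - xi) (eta - xi) <= l1_norm (l1_translate k mu - mu).
  rewrite /l1_norm -rsum_extend0//; apply: ler_rsum => [||g].
  - exact: rinner_summable.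
  - by apply: abs_summable_extend0; exact: l1_summable_abs.
  rewrite (_ : (eta - xi) g = eta g - xi g)//= oppr0 addr0 mulr0 addr0.
  rewrite extend0_translate /extend0; case: insub => [h|]; last by rewrite subrr mulr0.
  by rewrite -expr2 sqr_sqrtB.
have := rinner_ge0 (eta - xi); move: eta_xi.
rewrite rinnerBl !rinnerBr (rinnerC xi eta) rinner_left_regular rinner_sqrt_l1.
by rewrite ler_norml => ? ?; apply/andP; split; lra.
Qed.

(** The vector is supported on [S] and its translate on the coset [g S], which is disjoint from
    [S]. *)
Lemma rinner_sqrt_out g : g \notin sg_mem S ->
  rinner (left_regular g sqrt_l1) sqrt_l1 = 0.
Proof.
move=> gS; rewrite -[RHS](rsum0 R G); apply: eq_rsum => h /=.
rewrite mulr0 addr0; have [hS|/extend0_out->] := boolP (h \in sg_mem S); last first.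
  by rewrite mulr0.
rewrite extend0_out ?mul0r//; apply: contra gS => ghS.
have SM := group_closedM (sg_closed S); have SV := group_closedV (sg_closed S).
rewrite (_ : g = (h * (g^-1 * h)^-1)%g) ?SM ?SV//.
by rewrite invgM invgK mulVKg.
Qed.

Lemma rinner_lincomb_sqrt l : rinner (lincomb l sqrt_l1) sqrt_l1 =
  \sum_(p <- l) complex.Re p.1 * rinner (left_regular p.2 sqrt_l1) sqrt_l1.
Proof.
rewrite /lincomb; elim: l => [|p l IHl].
  by rewrite !big_nil -(subrr 0) rinnerBl subrr.
rewrite !big_cons rinnerDl IHl; congr (_ + _).
rewrite -rsumZ; last exact: rinner_summable.
apply: eq_rsum => g; set xi := left_regular p.2 sqrt_l1.
rewrite (_ : (p.1 *: xi) g = p.1 * xi g)//=.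
by case: p.1 => a b /=; rewrite !mulr0 subr0 !addr0 mulrA.
Qed.

End SquareRoot.

(* Test the operator on the square root of an almost invariant probability
   measure on the subgroup: translates by elements of the subgroup almost fix
   it, the other ones make it orthogonal to itself. *)
Lemma amenable_subgroup_le_norm l (M : R) : amenable R K ->
  (forall x : H, ell2_norm (lincomb l x) <= M * ell2_norm x) ->
  complex.Re (linear_ext (fun g => (g \in sg_mem S)%:R) l) <= M.
Proof.
move=> amK lM; rewrite Re_linear_ext.
apply/ler_addgt0Pr => e e0; pose c := \sum_(p <- l) `|complex.Re p.1|.
have c0 : 0 <= c by exact: sumr_ge0.
(* Elements outside [S] are replaced by the default [1]; their terms are handled by
   [rinner_sqrt_out] instead. *)
pose s (i : 'I_(size l)) : K := insubd 1%g (nth (0, 1%g) l i).2.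
(* The errors weighted by the coefficients add up to [c * (e / (c + 1)) <= e]; the [+ 1] covers
   [c = 0]. *)
have ec0 : 0 < e / (c + 1) by rewrite divr_gt0// ltr_wpDl.
have [mu [mu0 m_gt0 mus]] := reiter s amK ec0.
set m := l1_norm mu in m_gt0 mus; pose xi := sqrt_l1 mu0.
have xi_le p : p \in l -> `|rinner (left_regular p.2 xi) xi -
    (p.2 \in sg_mem S)%:R * m| <= e / (c + 1) * m.
  move=> /(nthP (0, 1%g))[i il <-]; set g := (nth _ _ _).2.
  have [gS|gS] := boolP (g \in sg_mem S); last first.
    by rewrite rinner_sqrt_out// mul0r subrr normr0 mulr_ge0// ltW.
  have sE : val (s (Ordinal il)) = g by rewrite val_insubd gS.
  by rewrite mul1r -sE (le_trans (rinner_sqrt_translate mu0 _)).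
have xiM : rinner (lincomb l xi) xi <= M * m.
  rewrite (le_trans (ler_rinner _ _))// -[m](rinner_sqrt_l1 mu0) -sqr_ell2_norm.
  by rewrite expr2 mulrA ler_wpM2r ?ell2_norm_ge0.
rewrite -(ler_pM2r m_gt0) mulr_suml.
apply: (@le_trans _ _ (\sum_(p <- l) (complex.Re p.1 *
    rinner (left_regular p.2 xi) xi + `|complex.Re p.1| * (e / (c + 1) * m)))).
  rewrite big_seq [leRHS]big_seq ler_sum// => p pl.
  rewrite -[leLHS]mulrA -lerBlDl -mulrBr (le_trans (ler_norm _))// normrM ler_wpM2l//.
  by rewrite distrC xi_le.
rewrite big_split/= -rinner_lincomb_sqrt -mulr_suml -/c mulrDl lerD//.
rewrite mulrA ler_wpM2r ?(ltW m_gt0)// mulrCA ger_pMr// ler_pdivrMr ?mul1r.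
  by rewrite lerDl.
by rewrite ltr_wpDl.
Qed.

End AmenableSubgroup.

(** * Norm approximation of operators by the group algebra *)

Section Approximation.
Variables (R : realType) (G : groupType).
Local Notation H := (ell2 R G).
Local Notation normc := ComplexField.Normc.normc.
Local Notation comb := (seq (R[i] * G)).
Implicit Types (l m : comb) (x y : H) (S T : H -> H) (a : R[i]).

Definition comb_scale a l : comb := [seq (a * p.1, p.2) | p <- l].

Definition comb_mul l m : comb :=
  [seq (p.1 * q.1, (p.2 * q.2)%g) | p <- l, q <- m].

Definition comb_star l : comb := [seq (p.1^*%C, p.2^-1%g) | p <- l].

Lemma lincomb_cat l m x : lincomb (l ++ m) x = lincomb l x + lincomb m x.
Proof. exact: big_cat. Qed.

Lemma lincomb_scale a l x : lincomb (comb_scale a l) x = a *: lincomb l x.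
Proof.
by rewrite /lincomb big_map scaler_sumr; apply: eq_bigr => p _; rewrite scalerA.
Qed.

Lemma lincomb_mul l m x : lincomb (comb_mul l m) x = lincomb l (lincomb m x).
Proof.
rewrite /lincomb big_allpairs_dep; apply: eq_bigr => p _.
rewrite linear_sum scaler_sumr; apply: eq_bigr => q _ /=.
by rewrite left_regularM linearZ scalerA.
Qed.

Lemma linear_ext_cat (phi : G -> R) l m :
  linear_ext phi (l ++ m) = linear_ext phi l + linear_ext phi m.
Proof. exact: big_cat. Qed.

Lemma linear_ext_scale (phi : G -> R) a l :
  linear_ext phi (comb_scale a l) = a * linear_ext phi l.
Proof.
by rewrite /linear_ext big_map mulr_sumr; apply: eq_bigr => p _; rewrite mulrA.
Qed.

Lemma linear_ext_mulC (phi : G -> R) l m :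
  (forall g h, phi (g * h)%g = phi (h * g)%g) ->
  linear_ext phi (comb_mul l m) = linear_ext phi (comb_mul m l).
Proof.
move=> phiC; rewrite /linear_ext !big_allpairs_dep exchange_big.
by apply: eq_bigr => p _; apply: eq_bigr => q _ /=; rewrite phiC [q.1 * _]mulrC.
Qed.

Lemma rinner_conjZ a x y : rinner (a *: x) y = rinner x (a^*%C *: y).
Proof.
apply: eq_rsum => g; rewrite (_ : (a *: x) g = a * x g)//.
rewrite (_ : (a^*%C *: y) g = a^*%C * y g)//.
by case: a (x g) (y g) => [? ?] [? ?] [? ?] /=; ring.
Qed.

Lemma rinner_lincomb l x y : rinner (lincomb l x) y = rinner x (lincomb (comb_star l) y).
Proof.
rewrite /lincomb big_map; elim: l => [|p l IHl].
  by rewrite !big_nil -(subrr 0) rinnerBl rinnerBr [0 in RHS]lock; rewrite !subrr.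
rewrite !big_cons rinnerDl rinnerDr IHl; congr (_ + _).
by rewrite rinner_conjZ rinner_left_regularV linearZ.
Qed.

Lemma ler_normcD (a b : R[i]) : normc (a + b) <= normc a + normc b.
Proof. exact: le_normcD. Qed.

Lemma normc_opp (a : R[i]) : normc (- a) = normc a.
Proof. exact: normcN. Qed.

Lemma normc_ge0 a : 0 <= normc a.
Proof. by case: a => ? ?; exact: sqrtr_ge0. Qed.

Lemma normc_le_ReIm a : normc a <= `|complex.Re a| + `|complex.Im a|.
Proof.
case: a => u v /=; rewrite -ler_sqr ?nnegrE ?sqrtr_ge0 ?addr_ge0//.
rewrite sqr_sqrtr ?addr_ge0 ?sqr_ge0// sqrrD !real_normK ?num_real//.
by rewrite lerD2r lerDl mulrn_wge0// mulr_ge0.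
Qed.

Lemma normc_small_eq0 a (c : R) : 0 <= c ->
  (forall e, 0 < e -> normc a <= c * e) -> a = 0.
Proof.
move=> c0 ae; apply: ComplexField.Normc.eq0_normc; apply/le_anti.
rewrite normc_ge0 andbT; apply/ler_addgt0Pr => e e0; rewrite add0r.
have c1 : 0 < c + 1 by rewrite ltr_wpDl.
rewrite (le_trans (ae (e / (c + 1)) _)) ?divr_gt0//.
by rewrite mulrCA ger_pMr// ler_pdivrMr// mul1r lerDl.
Qed.

Lemma linear_opB T x y : linear T -> T (x - y) = T x - T y.
Proof.
by move=> Tlin; rewrite addrC -scaleN1r Tlin scaleN1r addrC.
Qed.

Lemma bounded_operator_nneg T : bounded_operator T ->
  exists2 M : R, 0 <= M & forall x, ell2_norm (T x) <= M * ell2_norm x.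
Proof.
move=> [_ [M TM]]; exists `|M| => // x; rewrite (le_trans (TM x))//.
by rewrite ler_wpM2r ?ell2_norm_ge0// ler_norm.
Qed.

Lemma lincomb_bounded l : bounded_operator (lincomb l).
Proof.
split; first exact: lincomb_linear.
exists (\sum_(p <- l) normc p.1) => x; rewrite /lincomb.
elim: l => [|p l IHl]; first by rewrite !big_nil mul0r ell2_norm0.
rewrite !big_cons mulrDl (le_trans (ler_ell2_normD _ _))// lerD//.
by rewrite ell2_normZ ell2_norm_left_regular.
Qed.

(** A bound on the norm of [T - lincomb l] written without a supremum, so that it makes sense for
    maps not yet known to be linear or bounded, such as adjoints. *)
Definition approximates l (e : R) T : Prop :=
  forall x, ell2_norm (T x - lincomb l x) <= e * ell2_norm x.

Lemma approximates_lincomb l : approximates l 0 (lincomb l).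
Proof. by move=> x; rewrite subrr ell2_norm0 mul0r. Qed.

Lemma approximates_left_regular g : approximates [:: (1, g)] 0 (@left_regular R G g).
Proof.
by move=> x; rewrite /lincomb big_seq1 /= scale1r subrr ell2_norm0 mul0r.
Qed.

Lemma approximates_le l (d e : R) T : d <= e -> approximates l d T -> approximates l e T.
Proof.
by move=> de lT x; rewrite (le_trans (lT x))// ler_wpM2r ?ell2_norm_ge0.
Qed.

Lemma approximates_linear a l m (d e : R) S T :
  approximates l d S -> approximates m e T ->
  approximates (comb_scale a l ++ m) (normc a * d + e) (fun x => a *: S x + T x).
Proof.
move=> lS mT x; rewrite lincomb_cat lincomb_scale opprD addrACA -scalerBr.
rewrite (le_trans (ler_ell2_normD _ _))// mulrDl lerD// ell2_normZ -mulrA.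
by rewrite ler_wpM2l ?normc_ge0.
Qed.

(** Write [S T - l m = S (T - m) + (S - l) m]. As [e <= 1], the norm of [m] is at most [N + 1], so
    the constant depends on [S] and [T] only. *)
Lemma approximates_comp S T : bounded_operator S -> bounded_operator T ->
  exists2 c : R, 0 <= c & forall l m (e : R), 0 <= e <= 1 ->
    approximates l e S -> approximates m e T ->
    approximates (comb_mul l m) (c * e) (S \o T).
Proof.
move=> Sb Tb.
have [M M0 SM] := bounded_operator_nneg Sb; have [N N0 TN] := bounded_operator_nneg Tb.
exists (M + N + 1) => [|l m e /andP[e0 e1] lS mT x]; first by rewrite !addr_ge0.
set y := lincomb m x; have y_le : ell2_norm y <= (N + 1) * ell2_norm x.
  rewrite -[y](subrK (T x)) (le_trans (ler_ell2_normD _ _))// addrC mulrDl lerD//.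
  by rewrite ell2_distC (le_trans (mT x))// ler_wpM2r ?ell2_norm_ge0.
rewrite lincomb_mul -/y /= -[S (T x)](subrK (S y)) -addrA.
rewrite -(linear_opB _ _ Sb.1) (le_trans (ler_ell2_normD _ _))//.
rewrite -addrA !mulrDl lerD//.
  by rewrite (le_trans (SM _))// -mulrA ler_wpM2l.
rewrite -!mulrDl (le_trans (lS _))// mulrAC [leRHS]mulrC.
by rewrite ler_wpM2l.
Qed.

(** For [w = S y - l^* y], moving the operators to the other side bounds the square of the norm of
    [w] by the product of the norms of [(T - l) w] and [y]; then divide by the norm of [w]. *)
Lemma approximates_adjoint T S l (e : R) : is_adjoint T S ->
  approximates l e T -> 0 <= e -> approximates (comb_star l) e S.
Proof.
move=> TS lT e0 y; set w := S y - _.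
have w2 : ell2_norm w ^+ 2 <= e * ell2_norm w * ell2_norm y.
  rewrite sqr_ell2_norm {2}/w rinnerBr -rinner_lincomb -Re_inner -TS Re_inner.
  rewrite -rinnerBl (le_trans (ler_rinner _ _))//.
  by rewrite ler_wpM2r ?ell2_norm_ge0.
have [w0|w0] := eqVneq (ell2_norm w) 0.
  by rewrite w0 mulr_ge0 ?ell2_norm_ge0.
have {}w0 : 0 < ell2_norm w by rewrite lt_def w0 ell2_norm_ge0.
by rewrite -(ler_pM2l w0) -expr2 mulrCA mulrA.
Qed.

Lemma ler_op_norm T x : bounded_operator T ->
  ell2_norm (T x) <= op_norm T * ell2_norm x.
Proof.
move=> Tb; have [M M0 TM] := bounded_operator_nneg Tb.
have [x0|x0] := eqVneq (ell2_norm x) 0.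
  by rewrite x0 mulr0 (le_trans (TM x))// x0 mulr0.
have {}x0 : 0 < ell2_norm x by rewrite lt_def x0 ell2_norm_ge0.
have T0 : T 0 = 0 by rewrite -(subrr 0) linear_opB ?subrr//; case: Tb.
have TZ a y : T (a *: y) = a *: T y by rewrite -[_ *: y]addr0 Tb.1 T0 addr0.
rewrite -ler_pdivrMr// mulrC.
have nZ y : ell2_norm ((ell2_norm x)^-1%:C%C *: y) = (ell2_norm x)^-1 * ell2_norm y.
  by rewrite ell2_normZ normc_real ger0_norm// invr_ge0 ltW.
rewrite -nZ -TZ; apply: ub_le_sup.
  exists M => _ [y /= y1 <-]; rewrite (le_trans (TM y))// -[leRHS]mulr1.
  by rewrite ler_wpM2l.
by exists ((ell2_norm x)^-1%:C%C *: x) => //=; rewrite nZ mulVf ?gt_eqF.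
Qed.

(** The norm closure of the group algebra: one of the algebras whose intersection is
    [reduced_cstar], hence an upper bound for it. *)
Definition approximable : set (H -> H) := [set T | bounded_operator T /\
  forall e : R, 0 < e -> exists l, approximates l e T].

Lemma bounded_operator_linear a S T : bounded_operator S -> bounded_operator T ->
  bounded_operator (fun x => a *: S x + T x).
Proof.
move=> Sb Tb; split=> [b x y|].
  by rewrite Sb.1 Tb.1 !scalerDr !scalerA addrACA mulrC.
have [M M0 SM] := bounded_operator_nneg Sb; have [N N0 TN] := bounded_operator_nneg Tb.
exists (normc a * M + N) => x; rewrite (le_trans (ler_ell2_normD _ _))// mulrDl lerD//.
by rewrite ell2_normZ -mulrA ler_wpM2l ?normc_ge0.
Qed.

Lemma bounded_operator_comp S T : bounded_operator S -> bounded_operator T ->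
  bounded_operator (S \o T).
Proof.
move=> Sb Tb; split=> [b x y|]; first by rewrite /= Tb.1 Sb.1.
have [M M0 SM] := bounded_operator_nneg Sb; have [N N0 TN] := bounded_operator_nneg Tb.
by exists (M * N) => x; rewrite (le_trans (SM _))// -mulrA ler_wpM2l.
Qed.

(** Linearity and boundedness of [S] are inherited from the combinations [l^*], whose error at [x]
    is a small multiple of the norm of [x]. *)
Lemma approximable_adjoint T S : approximable T -> is_adjoint T S -> approximable S.
Proof.
move=> [Tb Tl] TS.
have Sl (e : R) : 0 < e -> exists l, approximates l e S.
  move=> e0; have [l lT] := Tl _ e0; exists (comb_star l).
  exact: approximates_adjoint TS lT (ltW e0).
split=> //; split=> [a x y|].
  apply/eqP; rewrite -subr_eq0; apply/eqP/ell2_norm_eq0/le_anti.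
  rewrite ell2_norm_ge0 andbT; apply/ler_addgt0Pr => e e0; rewrite add0r.
  pose c := ell2_norm (a *: x + y) + (normc a * ell2_norm x + ell2_norm y).
  have c0 : 0 <= c by rewrite !addr_ge0 ?mulr_ge0 ?normc_ge0 ?ell2_norm_ge0.
  have c1 : 0 < c + 1 by rewrite ltr_wpDl.
  have d0 : 0 < e / (c + 1) by rewrite divr_gt0.
  have [l lS] := Sl _ d0; apply: (@le_trans _ _ (e / (c + 1) * c)); last first.
    by rewrite mulrAC ler_pdivrMr// ler_pM2l// lerDl.
  have -> : S (a *: x + y) - (a *: S x + S y) =
     (S (a *: x + y) - lincomb l (a *: x + y)) -
     (a *: (S x - lincomb l x) + (S y - lincomb l y)).
    rewrite [lincomb l (_ + _)]linearP scalerBr addrACA -opprD.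
    have subrKK (u v w : H) : u - v = (u - w) - (v - w) by rewrite opprB addrA subrK.
    exact: subrKK.
  rewrite (le_trans (ler_ell2_normD _ _))// mulrDr lerD// ell2_normN.
  rewrite (le_trans (ler_ell2_normD _ _))// mulrDr lerD// ell2_normZ mulrCA.
  by rewrite ler_wpM2l ?normc_ge0.
have [l lS] := Sl 1 ltr01; have [M M0 lM] := bounded_operator_nneg (lincomb_bounded l).
exists (1 + M) => x; rewrite -[S x](subrK (lincomb l x)).
by rewrite (le_trans (ler_ell2_normD _ _))// mulrDl lerD.
Qed.

Lemma approximable_cstar : cstar_subalgebra approximable.
Proof.
split.
- by move=> T [].
- have zE : (fun _ : H => 0 : H) = lincomb [::] by apply/funext => x; rewrite /lincomb big_nil.
  rewrite zE; split; first exact: lincomb_bounded.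
  move=> e e0; exists [::].
  exact: approximates_le (ltW e0) (approximates_lincomb _).
- move=> a S T [Sb Sl] [Tb Tl]; split; first exact: bounded_operator_linear.
  move=> e e0; have a1 : 0 < normc a + 1 by rewrite ltr_wpDl ?normc_ge0.
  have d0 : 0 < e / (normc a + 1) by rewrite divr_gt0.
  have [l lS] := Sl _ d0; have [m mT] := Tl _ d0.
  exists (comb_scale a l ++ m); apply: approximates_le (approximates_linear a lS mT).
  by rewrite -{2}[e / _]mul1r -mulrDl mulrCA divff ?mulr1// gt_eqF.
- move=> S T [Sb Sl] [Tb Tl]; split; first exact: bounded_operator_comp.
  move=> e e0; have [c c0 cST] := approximates_comp Sb Tb.
  have c1 : 0 < c + 1 by rewrite ltr_wpDl.
  (* The cap at [1] meets the hypothesis of [approximates_comp]; the other term makes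
     [c * d <= e]. *)
  pose d := Num.min 1 (e / (c + 1)).
  have d0 : 0 < d by rewrite lt_min ltr01 divr_gt0.
  have [l lS] := Sl _ d0; have [m mT] := Tl _ d0.
  exists (comb_mul l m); apply: approximates_le (cST _ _ _ _ lS mT).
    rewrite (@le_trans _ _ (c * (e / (c + 1))))//.
      by rewrite ler_wpM2l// ge_min lexx orbT.
    by rewrite mulrCA ger_pMr// ler_pdivrMr// mul1r lerDl.
  by rewrite (ltW d0) ge_min lexx.
- exact: approximable_adjoint.
- move=> T Tb TS; split=> // e e0; have e2 : 0 < e / 2 by rewrite divr_gt0.
  have [S [Sb Sl] ST] := TS _ e2; have [l lS] := Sl _ e2; exists l => x.
  have TSb : bounded_operator (fun x => T x - S x).
    rewrite (_ : (fun x => _) = fun x => (-1) *: S x + T x).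
      exact: bounded_operator_linear.
    by apply/funext => y; rewrite scaleN1r addrC.
  rewrite -[T x](subrK (S x)) -addrA (le_trans (ler_ell2_normD _ _))//.
  rewrite [e]splitr mulrDl lerD// (le_trans (ler_op_norm x TSb))//.
  by rewrite ler_wpM2r ?ell2_norm_ge0// ltW.
Qed.

Lemma reduced_cstar_approximable T : reduced_cstar T -> approximable T.
Proof.
apply; split; first exact: approximable_cstar.
move=> g; split.
  split; first exact: left_regular_linear.
  by exists 1 => x; rewrite mul1r ell2_norm_left_regular.
move=> e e0; exists [:: (1, g)].
exact: approximates_le (ltW e0) (approximates_left_regular g).
Qed.

Lemma left_regular_reduced_cstar g : reduced_cstar (@left_regular R G g).
Proof. by move=> A [_]. Qed.

End Approximation.

(** * From characters of G to tracial states of C*_r(G) *)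

Section TracialState.
Variables (R : realType) (G : groupType).
Local Notation H := (ell2 R G).
Local Notation normc := ComplexField.Normc.normc.
Local Notation comb := (seq (R[i] * G)).

(* The third condition says that the linear extension of [phi] is continuous
   for the norm of C*_r(G). *)
Record reduced_character (phi : G -> R) : Prop := ReducedCharacter {
  rchar1 : phi 1%g = 1;
  rcharC : forall g h, phi (g * h)%g = phi (h * g)%g;
  rchar_le : forall l (M : R),
    (forall x : H, ell2_norm (lincomb l x) <= M * ell2_norm x) ->
    complex.Re (linear_ext phi l) <= M;
  rchar_pos : forall l, 0 <= linear_ext phi (comb_mul (comb_star l) l) }.

(** A limit that chooses no approximating sequence: each pair [(l, e)] gives the lower bound
    [f l - e] for the value at [T]. When [f] is 1-Lipschitz for the operator norm, the supremum lies
    within [e] of every [f l]. *)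
Definition approx_limit (f : comb -> R) (T : H -> H) : R :=
  sup [set f l.1 - l.2 | l in [set l | approximates l.1 l.2 T]].

Lemma approx_limitP (f : comb -> R) (T : H -> H) :
  (forall l m (d e : R), approximates l d T -> approximates m e T ->
     f l - f m <= d + e) ->
  forall l (e : R), approximates l e T -> `|approx_limit f T - f l| <= e.
Proof.
move=> f_le l e lT; rewrite ler_distl; apply/andP; split.
  apply: ub_le_sup; last by exists (l, e).
  exists (f l + e) => _ [[m d] /= mT <-].
  by have := f_le _ _ _ _ mT lT; lra.
apply: ge_sup; first by exists (f l - e), (l, e).
move=> _ [[m d] /= mT <-].
by have := f_le _ _ _ _ mT lT; lra.
Qed.

Section OfCharacter.
Variable phi : G -> R.
Hypothesis phi_char : reduced_character phi.
Implicit Types (l m : comb) (S T : H -> H).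

Definition character_trace T : R[i] :=
  (approx_limit (fun l => complex.Re (linear_ext phi l)) T +i*
   approx_limit (fun l => complex.Im (linear_ext phi l)) T)%C.

Lemma character_trace_ReIm l (e : R) T : approximates l e T ->
  `|complex.Re (character_trace T - linear_ext phi l)| <= e /\
  `|complex.Im (character_trace T - linear_ext phi l)| <= e.
Proof.
move=> lT; rewrite !raddfB /=.
(* Two combinations close to [T] differ by at most [d1 + d2] in norm. The factor [a = 1] selects the
   real part of the difference of values and [a = -i] the imaginary part. *)
have diff l1 l2 (d1 d2 : R) (a : R[i]) : normc a = 1 -> approximates l1 d1 T ->
    approximates l2 d2 T ->
    complex.Re (a * (linear_ext phi l1 - linear_ext phi l2)) <= d1 + d2.
  move=> a1 l1T l2T; rewrite -[- _]mulN1r -linear_ext_scale -linear_ext_cat.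
  rewrite -linear_ext_scale; apply: (rchar_le phi_char) => x.
  rewrite lincomb_scale lincomb_cat lincomb_scale scaleN1r ell2_normZ a1 mul1r.
  rewrite -[lincomb l1 x](subrK (T x)) -addrA mulrDl.
  by rewrite (le_trans (ler_ell2_normD _ _))// lerD// ell2_distC.
split; apply: approx_limitP => // l1 l2 d1 d2 l1T l2T.
  have := diff l1 l2 d1 d2 1; rewrite mul1r raddfB; apply => //.
  by rewrite /= expr0n/= addr0 expr1n sqrtr1.
have := diff l1 l2 d1 d2 (0 -i* 1)%C.
rewrite -raddfB; case: (linear_ext phi l1 - linear_ext phi l2) => u v /=.
rewrite mul0r sub0r mulN1r opprK; apply => //.
by rewrite expr0n/= add0r sqrrN expr1n sqrtr1.
Qed.

Lemma character_trace_approx l (e : R) T : approximates l e T ->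
  normc (character_trace T - linear_ext phi l) <= 2 * e.
Proof.
move=> /character_trace_ReIm[re im]; rewrite (le_trans (normc_le_ReIm _))//.
by move: re im; move: `|_| `|_| => u v; lra.
Qed.

Lemma character_trace_left_regular g :
  character_trace (@left_regular R G g) = (phi g)%:C%C.
Proof.
have := character_trace_approx (@approximates_left_regular R G g).
rewrite mulr0 /linear_ext big_seq1 mul1r => le0.
apply/eqP; rewrite -subr_eq0; apply/eqP/(normc_small_eq0 (lexx 0)) => e e0.
by rewrite mul0r.
Qed.

Lemma character_trace_linear a S T : approximable S -> approximable T ->
  character_trace (fun x => a *: S x + T x) =
  a * character_trace S + character_trace T.
Proof.
move=> [_ Sl] [_ Tl]; apply/eqP; rewrite -subr_eq0; apply/eqP.
(* One half of the constant comes from the error on the combined operator, the other from the errors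
   on [a *: S] and [T]; each is [2 * (normc a + 1) * e]. *)
have c0 : 0 <= 4 * (normc a + 1) by rewrite mulr_ge0// addr_ge0 ?normc_ge0.
apply: (normc_small_eq0 c0) => e e0.
have [l lS] := Sl _ e0; have [m mT] := Tl _ e0.
have := character_trace_approx (approximates_linear a lS mT).
have tS := character_trace_approx lS; have tT := character_trace_approx mT.
rewrite linear_ext_cat linear_ext_scale.
set u := character_trace _; set v := character_trace S; set w := character_trace T.
set p := linear_ext phi l in tS *; set q := linear_ext phi m in tT * => tST.
have -> : u - (a * v + w) = (u - (a * p + q)) + (- (a * (v - p)) + - (w - q)).
  by ring.
have tSa := ler_wpM2l (normc_ge0 a) tS.
have := ler_normcD (- (a * (v - p))) (- (w - q)).
rewrite !normc_opp ComplexField.Normc.normcM => /le_trans/(_ (lerD tSa tT)) tD.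
rewrite (le_trans (ler_normcD _ _))// (le_trans (lerD tST tD))//.
by rewrite le_eqVlt; apply/orP; left; apply/eqP; ring.
Qed.

(** The products [l m] and [m l] approximate [S T] and [T S], and [phi] takes the same value on both
    since it is central. *)
Lemma character_trace_comp S T : approximable S -> approximable T ->
  character_trace (S \o T) = character_trace (T \o S).
Proof.
move=> [Sb Sl] [Tb Tl]; apply/eqP; rewrite -subr_eq0; apply/eqP.
have [c c0 cST] := approximates_comp Sb Tb; have [d d0 dTS] := approximates_comp Tb Sb.
have cd0 : 0 <= 2 * (c + d) by rewrite mulr_ge0// addr_ge0.
apply: (normc_small_eq0 cd0) => e e0; pose e1 := Num.min 1 e.
have e1_gt0 : 0 < e1 by rewrite lt_min ltr01.
have e1_le1 : 0 <= e1 <= 1 by rewrite (ltW e1_gt0) ge_min lexx.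
have e1e : e1 <= e by rewrite ge_min lexx orbT.
have [l lS] := Sl _ e1_gt0; have [m mT] := Tl _ e1_gt0.
have tST := character_trace_approx (cST _ _ _ e1_le1 lS mT).
have := character_trace_approx (dTS _ _ _ e1_le1 mT lS).
rewrite (linear_ext_mulC _ _ (rcharC phi_char)) => tTS.
set p := linear_ext phi _ in tST tTS.
rewrite -[character_trace (S \o T)](subrK p) -addrA -[p - _]opprB.
rewrite (le_trans (ler_normcD _ _))// normc_opp.
apply: (@le_trans _ _ (2 * (c + d) * e1)); last by rewrite ler_wpM2l.
by rewrite mulrDr mulrDl -!mulrA lerD.
Qed.

(** If [l] approximates [T], then [l^*] approximates [S], so [S T] is a limit of products [l^* l].
    Nonnegativity in [R[i]] includes a vanishing imaginary part, so both parts are estimated. *)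
Lemma character_trace_pos T S : approximable T -> is_adjoint T S ->
  0 <= character_trace (S \o T).
Proof.
move=> TA TS; have [Sb _] := approximable_adjoint TA TS; have [Tb Tl] := TA.
have [c c0 cST] := approximates_comp Sb Tb.
have small (e : R) : 0 < e -> - e <= complex.Re (character_trace (S \o T)) /\
    `|complex.Im (character_trace (S \o T))| <= e.
  move=> e0; pose d := Num.min 1 (e / (c + 1)).
  have c1 : 0 < c + 1 by rewrite ltr_wpDl.
  have d_gt0 : 0 < d by rewrite lt_min ltr01 divr_gt0.
  have d_le1 : 0 <= d <= 1 by rewrite (ltW d_gt0) ge_min lexx.
  have cd : c * d <= e.
    rewrite (@le_trans _ _ (c * (e / (c + 1))))//.
      by rewrite ler_wpM2l// ge_min lexx orbT.
    by rewrite mulrCA ger_pMr// ler_pdivrMr// mul1r lerDl.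
  have [l lT] := Tl _ d_gt0; have lS := approximates_adjoint TS lT (ltW d_gt0).
  have [] := character_trace_ReIm (cST _ _ _ d_le1 lS lT).
  have := rchar_pos phi_char l; rewrite lecE => /andP[/eqP im re].
  rewrite !raddfB /= im subr0 => re_le im_le; split; last exact: le_trans im_le cd.
  by move: re re_le; rewrite ler_norml => /= ? /andP[]; lra.
rewrite lecE; apply/andP; split.
  rewrite -normr_eq0 -[_ == _]/(_ == _) /=; apply/eqP/le_anti; rewrite normr_ge0 andbT.
  by apply/ler_addgt0Pr => e /small[_]; rewrite add0r.
by apply/ler_addgt0Pr => e /small[]; rewrite -[complex.Re 0]/0; lra.
Qed.

Lemma character_trace_tracial : tracial_state character_trace.
Proof.
split.
- by move=> a S T /reduced_cstar_approximable ? /reduced_cstar_approximable ?;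
    exact: character_trace_linear.
- have -> : idfun = @left_regular R G 1%g by apply/funext => x; rewrite left_regular1.
  by rewrite character_trace_left_regular (rchar1 phi_char).
- by move=> T S /reduced_cstar_approximable; exact: character_trace_pos.
- by move=> S T /reduced_cstar_approximable ? /reduced_cstar_approximable ?;
    exact: character_trace_comp.
Qed.

End OfCharacter.

Lemma unique_trace_character phi psi : unique_trace_property R G ->
  reduced_character phi -> reduced_character psi -> phi =1 psi.
Proof.
move=> [t _ t_unique] phi_char psi_char g.
have := t_unique _ (character_trace_tracial phi_char) _ (@left_regular_reduced_cstar R G g).
rewrite -(t_unique _ (character_trace_tracial psi_char) _ (@left_regular_reduced_cstar R G g)).
by rewrite !character_trace_left_regular// => -[].
Qed.

End TracialState.

(** * Positive definiteness of the indicator of a subgroup *)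

Section SubgroupCharacter.
Variables (R : realType) (G : groupType) (S : subgroup G).

Definition in_subgroup (g : G) : R := (g \in sg_mem S)%:R.

Lemma in_subgroup1 : in_subgroup 1%g = 1.
Proof. by rewrite /in_subgroup (sg_closed S).1. Qed.

(** The set is the coset [g S], and [xget] depends on the set only, so elements of one left coset
    share their representative. *)
Definition coset_repr (g : G) : G := xget 1%g [set x | (g^-1 * x)%g \in sg_mem S].

Lemma coset_reprP g : (g^-1 * coset_repr g)%g \in sg_mem S.
Proof.
rewrite /coset_repr; case: xgetP => [x _ //|/(_ g)/=].
by rewrite mulVg (sg_closed S).1.
Qed.

Lemma eq_coset_repr g h : (coset_repr g == coset_repr h) = ((g^-1 * h)%g \in sg_mem S).
Proof.
have SM := group_closedM (sg_closed S); have SV := group_closedV (sg_closed S).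
apply/eqP/idP => [gh|ghS].
  have := SM _ _ (coset_reprP g) (SV _ (coset_reprP h)).
  by rewrite -gh [(h^-1 * _)^-1%g]invgM invgK mulgA mulgK.
congr xget; apply/seteqP; split=> x /= xS.
  have -> : (h^-1 * x = (g^-1 * h)^-1 * (g^-1 * x))%g.
    by rewrite invgM invgK mulgA mulgK.
  by rewrite SM// SV.
have -> : (g^-1 * x = (g^-1 * h) * (h^-1 * x))%g by rewrite mulgA mulgK.
exact: SM.
Qed.

(* The sum splits over the left cosets of [S] into squared moduli. *)
Lemma in_subgroup_pos (l : seq (R[i] * G)) :
  0 <= linear_ext in_subgroup (comb_mul (comb_star l) l).
Proof.
(* The total weight of [l] on the coset represented by [r]; [undup] below counts each coset once. *)
pose w r : R[i] := \sum_(p <- l) p.1 * (coset_repr p.2 == r)%:R.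
rewrite (_ : linear_ext _ _ =
    \sum_(r <- undup [seq coset_repr p.2 | p <- l]) (w r * (w r)^*%C)).
  by apply: sumr_ge0 => r _; exact: mulcJ_ge0.
have wE r : w r * (w r)^*%C = \sum_(p <- l) \sum_(q <- l) (p.1^*%C * q.1) *
    ((coset_repr p.2 == r)%:R * (coset_repr q.2 == r)%:R).
  rewrite mulrC /w rmorph_sum mulr_suml; apply: eq_bigr => p _.
  rewrite mulr_sumr; apply: eq_bigr => q _.
  by rewrite rmorphM rmorph_nat mulrACA.
under [RHS]eq_bigr do rewrite wE.
rewrite exchange_big /linear_ext big_allpairs_dep big_map big_seq [RHS]big_seq.
apply: eq_bigr => p pl; rewrite exchange_big; apply: eq_bigr => q _.
rewrite -mulr_sumr /= /in_subgroup -eq_coset_repr; congr (_ * _).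
rewrite (bigD1_seq (coset_repr p.2)) ?undup_uniq//=; last first.
  by rewrite mem_undup; apply/mapP; exists p.
rewrite big1 ?addr0 => [|r rp]; last by rewrite eq_sym (negbTE rp) mul0r.
by rewrite eqxx mul1r [in RHS]eq_sym; case: (_ == _).
Qed.

End SubgroupCharacter.

(** * The character of the canonical trace *)

Section TrivialSubgroup.
Variables (R : realType) (G : groupType).

Lemma amenable_trivial_subgroup : amenable R (subgroup_elt (trivial_subgroup G)).
Proof.
exists (fun f => f 1%g); split=> // g f _.
have val1 (k : subgroup_elt (trivial_subgroup G)) : val k = 1%g.
  exact/eqP/(valP k).
by congr f; apply: val_inj; rewrite !val1.
Qed.

Lemma trivial_subgroup_character :
  reduced_character (@in_subgroup R G (trivial_subgroup G)).
Proof.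
split; first exact: in_subgroup1.
- move=> g h; rewrite /in_subgroup !unfold_in /=; congr (_%:R).
  by rewrite !mulg_eq1 -eqg_inv invgK eq_sym.
- by move=> l M; apply: amenable_subgroup_le_norm; exact: amenable_trivial_subgroup.
- exact: in_subgroup_pos.
Qed.

End TrivialSubgroup.

(** * Integrating inequalities between indicators *)

Section Probability.
Context d (T : measurableType d) (R : realType) (P : probability T R).

Lemma probability_sum_ge0 (l : seq (R * set T)) :
  (forall p, p \in l -> measurable p.2) ->
  {ae P, forall x, 0 <= \sum_(p <- l) p.1 * \1_(p.2) x} ->
  0 <= \sum_(p <- l) p.1 * fine (P p.2).
Proof.
move=> ml [N [mN PN0 lN]].
(* Integrability and the value of the integral are proved together, since additivity of the integral
   asks for the integrability of the tail. *)
have [il intl] : P.-integrable setT (fun x => (\sum_(p <- l) p.1 * \1_(p.2) x)%:E) /\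
   (\int[P]_x (\sum_(p <- l) p.1 * \1_(p.2) x)%:E =
    (\sum_(p <- l) p.1 * fine (P p.2))%:E)%E.
  elim: l ml {lN} => [_|p l IHl ml].
    split; first by under eq_fun do rewrite big_nil; exact: integrable0.
    by under eq_integral => x _ do rewrite big_nil; rewrite big_nil integral0.
  have [|il intl] := IHl; first by move=> q ql; apply: ml; rewrite inE ql orbT.
  have mp : measurable p.2 by apply: ml; rewrite inE eqxx.
  have ip := integrableZl (@measurableT _ T) p.1 (integrable_indic P mp).
  have E x : (\sum_(q <- p :: l) q.1 * \1_(q.2) x)%:E =
      (p.1%:E * (\1_(p.2) x)%:E + (\sum_(q <- l) q.1 * \1_(q.2) x)%:E)%E.
    by rewrite big_cons EFinD EFinM.
  split; first by under eq_fun do rewrite E; exact: integrableD.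
  under eq_integral do rewrite E.
  rewrite integralD// intl integralZl//; last exact: integrable_indic.
  by rewrite integral_indic// setIT big_cons EFinD EFinM fineK// fin_num_measure.
rewrite -lee_fin -intl (negligible_integral mN)//.
apply: integral_ge0 => x [_ xN]; rewrite lee_fin.
by apply: contrapT => /lN.
Qed.

End Probability.

(** * The character of an invariant random subgroup *)

Section IRS.
Variables (R : realType) (G : groupType).
Variable theta : probability (subgroup_borel G) R.

Definition containing (g : G) : set (subgroup_borel G) := [set S | g \in sg_mem S].

(** The set is the preimage of [true] under the coordinate [g] of [2^G], hence open. *)
Lemma measurable_containing g : measurable (containing g).
Proof.
apply: sub_sigma_algebra.
rewrite (_ : containing g = (@sg_mem G : subgroup_space G -> {ptws G -> bool}) @^-1`
   ((fun f : {ptws G -> bool} => f g) @^-1` [set true])); last first.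
  by apply/seteqP; split => S /=.
apply: open_comp; first by move=> S _; exact: initial_continuous.
apply: open_comp; last exact: discrete_open.
by move=> f _; exact: (@proj_continuous G (fun=> bool)).
Qed.

Definition irs_character (g : G) : R := fine (theta (containing g)).

Lemma irs_character1 : irs_character 1%g = 1.
Proof.
rewrite /irs_character (_ : containing 1%g = setT) ?probability_setT//.
by apply/seteqP; split=> // S _; exact: (sg_closed S).1.
Qed.

(** Transfer principle: a real linear inequality satisfied by the indicator of almost every subgroup
    passes to their average [irs_character]. Continuity and positivity are both obtained from it. *)
Lemma irs_character_indic (l : seq (R * G)) :
  {ae theta, forall S : subgroup_borel G, 0 <= \sum_(p <- l) p.1 * in_subgroup R S p.2} ->
  0 <= \sum_(p <- l) p.1 * irs_character p.2.
Proof.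
move=> l0; have := @probability_sum_ge0 _ _ _ theta [seq (p.1, containing p.2) | p <- l].
rewrite big_map; apply.
  by move=> _ /mapP[p _ ->]; exact: measurable_containing.
apply: filterS l0 => S; rewrite big_map; congr (0 <= _); apply: eq_bigr => p _.
by rewrite indicE /= /in_subgroup; congr (_ * (nat_of_bool _)%:R);
  apply/idP/idP => [gS|]; [exact: mem_set|exact: set_mem].
Qed.

Lemma irs_reduced_character : invariant_random_subgroup theta -> amenable_irs theta ->
  reduced_character irs_character.
Proof.
move=> theta_inv theta_am; split.
- exact: irs_character1.
(* The conjugate of [S] by [g] contains [g * h] exactly when [S] contains [h * g]. *)
- move=> g h; rewrite /irs_character -(theta_inv g _ (measurable_containing _)).
  have gh : ((g * h) ^ g = h * g)%g by rewrite conjgE -mulgA mulKg.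
  by congr (fine (theta _)); apply/seteqP; split=> S /=;
    rewrite /containing /= inE gh.
- move=> l M lM; rewrite Re_linear_ext -subr_ge0.
  (* The constant [M] enters as a weight on the identity, which lies in every subgroup. *)
  have := @irs_character_indic ((M, 1%g) :: [seq (- complex.Re p.1, p.2) | p <- l]).
  rewrite big_cons big_map /= irs_character1 mulr1 -sumrN.
  under eq_bigr do rewrite mulNr; apply.
  apply: filterS theta_am => S amS.
  rewrite big_cons big_map /= in_subgroup1 mulr1.
  under eq_bigr do rewrite mulNr; rewrite sumrN subr_ge0 -Re_linear_ext.
  exact: amenable_subgroup_le_norm.
- move=> l; rewrite lecE Re_linear_ext Im_linear_ext.
  have pos S := @in_subgroup_pos R G S l; set k := comb_mul _ _ in pos *.
  have re : 0 <= \sum_(p <- k) complex.Re p.1 * irs_character p.2.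
    have := @irs_character_indic [seq (complex.Re p.1, p.2) | p <- k].
    rewrite big_map; apply; apply: aeW => S; rewrite big_map -Re_linear_ext.
    by have := pos S; rewrite lecE => /andP[].
  (* The imaginary part vanishes for every [S]; this equality is transferred as two opposite
     inequalities. *)
  rewrite re andbT; apply/eqP/le_anti; apply/andP; split.
    have := @irs_character_indic [seq (- complex.Im p.1, p.2) | p <- k].
    rewrite big_map; under eq_bigr do rewrite mulNr.
    rewrite sumrN oppr_ge0; apply; apply: aeW => S; rewrite big_map.
    under eq_bigr do rewrite mulNr.
    rewrite sumrN -Im_linear_ext oppr_ge0.
    by have := pos S; rewrite lecE => /andP[/eqP->].
  have := @irs_character_indic [seq (complex.Im p.1, p.2) | p <- k].
  rewrite big_map; apply; apply: aeW => S; rewrite big_map -Im_linear_ext.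
  by have := pos S; rewrite lecE => /andP[/eqP->].
Qed.

Lemma irs_character_trivial : countable [set: G] ->
  (forall g, g != 1%g -> irs_character g = 0) -> trivial_irs theta.
Proof.
move=> /countable_injP[f f_inj] theta0 A mA.
have f_inj' g h : f g = f h -> g = h by apply: f_inj; rewrite inE.
(* [N n] consists of the subgroups containing the element numbered [n]. If no element has this
   number, or if it is the identity, [xget] returns [1] and the second condition makes [N n]
   empty. *)
pose N n := containing (xget 1%g [set g | f g = n]) `&`
  [set S : subgroup_borel G | xget 1%g [set g | f g = n] != 1%g].
have N0 n : theta.-negligible (N n).
  have [x1|x1] := eqVneq (xget 1%g [set g | f g = n]) 1%g.
    rewrite (_ : N n = set0); first exact: negligible_set0.
    by apply/seteqP; split=> // S [_] /=; rewrite x1 eqxx.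
  exists (containing (xget 1%g [set g | f g = n])); split.
  - exact: measurable_containing.
  - rewrite -[LHS]fineK; last first.
      by apply: fin_num_measure; exact: measurable_containing.
    by rewrite -[fine _]/(irs_character _) theta0.
  - by move=> S [].
have N_nontrivial (S : subgroup_borel G) : S <> trivial_subgroup G -> (\bigcup_n N n) S.
  move=> Sne; apply: contrapT => SN; apply: Sne; apply: subgroup_eqP.
  apply/funext => g; apply/idP/idP => [gS|/eqP->]; last exact: (sg_closed S).1.
  apply/eqP; apply: contrapT => g1; apply: SN; exists (f g) => //.
  have fg : xget 1%g [set h | f h = f g] = g.
    by case: xgetP => [h _ /f_inj'//|/(_ g)/=/(_ erefl)].
  by split; rewrite /= fg//; apply/eqP.
have neg := negligible_bigcup N0.
(* A measurable set that misses the trivial subgroup is covered by the null sets [N n]. This is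
   applied below to [A] or to its complement. *)
have theta_out (B : set (subgroup_borel G)) : measurable B ->
    ~ B (trivial_subgroup G) -> theta B = 0%E.
  move=> mB triv_B; apply: measure_negligible => //; apply: negligibleS neg => S BS.
  by apply: N_nontrivial => Striv; apply: triv_B; rewrite -Striv.
rewrite diracE; have [Atriv|Atriv] := boolP (_ \in A).
  have := theta_out (~` A) (measurableC mA) (fun nA => nA (set_mem Atriv)).
  have thetaA : theta A \is a fin_num by exact: fin_num_measure.
  rewrite probability_setC// -(fineK thetaA) -EFinB => -[] /eqP.
  by rewrite subr_eq0 => /eqP <-.
by rewrite theta_out// => At; move/negP: Atriv; apply; exact: mem_set.
Qed.

End IRS.

Theorem theorem1p4 (R : realType) (G : groupType)
    (G_countable : countable [set: G]) :
  unique_trace_property R G ->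
  ~ exists theta : probability (subgroup_borel G) R,
      [/\ invariant_random_subgroup theta,
          amenable_irs theta &
          ~ trivial_irs theta].
Proof.
move=> unique_trace [theta [theta_inv theta_am]]; apply.
apply: irs_character_trivial => // g g1.
rewrite (unique_trace_character unique_trace (irs_reduced_character theta_inv theta_am)
  (trivial_subgroup_character R G)).
by rewrite /in_subgroup unfold_in /= (negbTE g1).
Qed.
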